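(* Let $\Gamma$ be any compact Dirichlet tree. Then for any integers $k>j\ge 1$ we have $$\frac{\lambda_k(\Gamma)}{\lambda_j(\Gamma)}\le 4^{\lceil \log_2\frac{k}{j}\rceil}\le 4\cdot\frac{k^2}{j^2}.$$
   Context: A compact metric graph $\Gamma=(\mathcal V,\mathcal E)$ has finitely many vertices and edges; each edge $e$ is identified with an interval $[0,\ell_e]$, $0<\ell_e<\infty$, whose endpoints are attached to vertices; $\Gamma$ is connected. It is a tree if $|\mathcal E|-|\mathcal V|+1=0$. A leaf is a vertex of degree one. $C(\Gamma)$ denotes the continuous functions on $\Gamma$ and $H^1(\Gamma)=\{f\in C(\Gamma): f|_e\in H^1(e)\ \forall e\in\mathcal E\}$. A compact Dirichlet tree is a compact tree $\Gamma$ equipped with the Laplacian $-\Delta$ (acting as $-f''$ on each edge) with a Dirichlet (zero) condition at every leaf and, at every other vertex, the Kirchhoff condition (continuity, and the sum of the derivatives along all incident edges, all oriented into the vertex, is zero). Equivalently, $-\Delta$ is the self-adjoint operator on $L^2(\Gamma)$ associated with the form $\int_\Gamma f'\overline{g}'\,dx$ on the set of $f\in H^1(\Gamma)$ vanishing at all leaves. Its eigenvalues, counted with multiplicity, are $0<\lambda_1(\Gamma)<\lambda_2(\Gamma)\le\lambda_3(\Gamma)\le\dots$. *)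

(* Defs.v *)
From HB Require Import structures.
From mathcomp Require Import all_boot all_order all_algebra.
From mathcomp Require Import all_classical all_reals all_analysis.

Set Implicit Arguments.
Unset Strict Implicit.
Unset Printing Implicit Defensive.

Import Order.TTheory GRing.Theory Num.Theory.
Import numFieldNormedType.Exports.

Local Open Scope classical_set_scope.
Local Open Scope ring_scope.

Definition adjacent (V E : finType) (endpoint : E -> bool -> V) : rel V :=
  fun u v =>
    [exists e, [exists b, (endpoint e b == u) && (endpoint e (~~ b) == v)]].

(* The edge e is the interval [0, len e]; an edge end is a pair (e, b), where
   b = false is the end 0 and b = true is the end len e, and endpoint e b is
   the vertex it is attached to. Loops and multiple edges are allowed. *)
Record metric_graph (R : realType) := MetricGraph {
  vertex : finType;
  edge : finType;
  endpoint : edge -> bool -> vertex;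
  len : edge -> R;
  len_gt0 : forall e, 0 < len e;
  connected_graph : forall u v, connect (adjacent endpoint) u v }.

Section MetricGraph.
Variables (R : realType) (G : metric_graph R).

Definition is_tree : Prop := (#|edge G|%:Z - #|vertex G|%:Z + 1 = 0)%R.

Definition degree (v : vertex G) : nat :=
  #|[set p : edge G * bool | endpoint p.1 p.2 == v]%SET|.

Definition is_leaf (v : vertex G) : Prop := degree v = 1%N.

Definition end_pos (e : edge G) (b : bool) : R := if b then len e else 0.

(* A function on G is given by its restrictions to the edges; only the values
   of f e on [0, len e] are meaningful. *)
Definition graph_fun : Type := edge G -> R -> R.

Definition continuous_at_vertices (f : graph_fun) : Prop :=
  forall (e e' : edge G) (b b' : bool), endpoint e b = endpoint e' b' ->
    f e (end_pos e b) = f e' (end_pos e' b').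

(* Twice differentiable inside the edge, with f and f' extending continuously
   to both ends; the extension of f is f itself. *)
Definition edge_regular (f : graph_fun) (e : edge G) : Prop :=
  [/\ derivable_oo_LRcontinuous (f e) 0 (len e),
      {in `]0, len e[, forall x, derivable (f e)^`()%classic x 1},
      cvg ((f e)^`()%classic x @[x --> 0^'+]) &
      cvg ((f e)^`()%classic x @[x --> (len e)^'-])].

Definition deriv_into (f : graph_fun) (e : edge G) (b : bool) : R :=
  if b then lim ((f e)^`()%classic x @[x --> (len e)^'-])
  else - lim ((f e)^`()%classic x @[x --> 0^'+]).

Definition dirichlet_kirchhoff (f : graph_fun) : Prop :=
  [/\ continuous_at_vertices f,
      forall e b, is_leaf (endpoint e b) -> f e (end_pos e b) = 0 &
      forall v, ~ is_leaf v ->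
        \sum_(p : edge G * bool | endpoint p.1 p.2 == v)
           deriv_into f p.1 p.2 = 0].

(* The eigenspace for mu: the eigenfunctions and the zero function. *)
Definition dirichlet_eigenspace (mu : R) : set graph_fun :=
  [set f | [/\ forall e, edge_regular f e,
               dirichlet_kirchhoff f &
               forall e, {in `]0, len e[, forall x,
                 - (f e)^`(2)%classic x = mu * f e x}]].

Definition lin_indep (k : nat) (F : 'I_k -> graph_fun) : Prop :=
  forall c : 'I_k -> R,
    (forall (e : edge G) (x : R), x \in `[0, len e] ->
       \sum_(i < k) c i * F i e x = 0) ->
    forall i, c i = 0.

(* At least k eigenvalues, counted with multiplicity, are at most mu. *)
Definition eigenvalue_count_ge (k : nat) (mu : R) : Prop :=
  exists (F : 'I_k -> graph_fun) (nu : 'I_k -> R),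
    lin_indep F /\ forall i, nu i <= mu /\ dirichlet_eigenspace (nu i) (F i).

(* The k-th eigenvalue in increasing order with multiplicity, starting from
   k = 1. *)
Definition dirichlet_eigenvalue (k : nat) : R :=
  inf [set mu | eigenvalue_count_ge k mu].

End MetricGraph.

(* Main.v *)
Require Import Defs.
From HB Require Import structures.
From mathcomp Require Import all_boot all_order all_algebra.
From mathcomp Require Import all_classical all_reals all_analysis.
From mathcomp Require Import ring lra zify.

Set Implicit Arguments.
Unset Strict Implicit.
Unset Printing Implicit Defensive.

Import Order.TTheory GRing.Theory Num.Theory.
Import numFieldNormedType.Exports.

Local Open Scope classical_set_scope.
Local Open Scope ring_scope.

(* Root the tree at a leaf. On a branch hanging below an edge, the functions
   solving -f'' = w^2 f and all vertex conditions of the branch restrict to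
   multiples of sin (phi + w y) on that edge, y being the distance to its lower
   end.
   The Pruefer angle phi is computed from the leaves upwards: at a vertex the
   cotangents of the incoming angles add up, and so do the half turns already
   completed. The number N(w) of half turns completed at the root counts the
   eigenvalues up to w^2: N is right-continuous, and its jump at w is the
   dimension of the eigenspace of w^2. Each step of the recursion is
   superhomogeneous, F(2 t) >= 2 F(t), because
   cot (2 t) = (cot t - 1 / cot t) / 2. Hence N(2 w) >= 2 N(w), that is
   lambda_(2 j) <= 4 lambda_j, and the theorem follows by iteration. *)

(** * Adding angles at a vertex *)

Section Angles.
Variable R : realType.
Implicit Types (x y c : R) (n : int).

(** The difficulty is that the angle is discontinuous in w. Suppose that m >= 1 branches meeting at
    a vertex vanish there for the same w. To the left of w the cotangents of these branches tend to
    -oo and each of them has one half turn less, so the combined angle stays about (m - 1) pi below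
    its value at w. These jumps are genuine multiplicities: m branch functions vanishing at the
    vertex, bound by the single Kirchhoff condition, leave m - 1 independent eigenfunctions
    supported below it. Everything about N is therefore stated with one-sided limits and integer
    jumps. Eigenvalues are compared with N without a spectral theorem: crossing them downwards one
    at a time shows that at most N(w) of them are up to w^2, and the jumps of N, filled with
    explicit sinusoids, provide that many. Since w is only compared with 2 w, the ratio k / j is
    rounded up to a power of 2, whence the ceiling; 4 is the square of the factor 2 on
    frequencies. *)

Definition wind x : int := Num.floor (x / pi).
Definition cot x : R := cos x / sin x.
(** The branch with values in ]0, pi[, which inverts [cot] within one half turn. *)
Definition acot c : R := pi / 2 - atan c.

Lemma wind_itv x : pi * (wind x)%:~R <= x < pi * (wind x)%:~R + pi.
Proof.
have pi0 := pi_gt0 R; have /andP[h1 h2] := floor_itv (x / pi).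
move: h1 h2; rewrite ler_pdivlMr // ltr_pdivrMr // intrD1 mulrDl mul1r.
by rewrite [_ * pi]mulrC => -> ->.
Qed.

Lemma wind_eq x n : pi * n%:~R <= x < pi * n%:~R + pi -> wind x = n.
Proof.
have pi0 := pi_gt0 R; move=> /andP[h1 h2]; apply: floor_def.
rewrite ler_pdivlMr // ltr_pdivrMr // intrD mulrDl mul1r mulrC h1 /=.
by [].
Qed.

Lemma windD x n : wind (x + pi * n%:~R) = wind x + n.
Proof.
apply: wind_eq; have /andP[h1 h2] := wind_itv x.
by rewrite intrD mulrDr lerD2r h1 /= addrAC ltrD2r.
Qed.

Lemma le_wind x y : x <= y -> wind x <= wind y.
Proof.
by move=> h; apply: le_floor; rewrite ler_pM2r // invr_gt0 pi_gt0.
Qed.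

Lemma sin_pi_nat (n : nat) : sin (pi * n%:R : R) = 0.
Proof.
elim: n => [|n IH]; first by rewrite mulr0 sin0.
by rewrite -natr1 mulrDr mulr1 sinDpi IH oppr0.
Qed.

Lemma sin_pi_int n : sin (pi * n%:~R : R) = 0.
Proof.
case: n => n; first by rewrite -pmulrn sin_pi_nat.
by rewrite NegzE mulrNz mulrN sinN -pmulrn sin_pi_nat oppr0.
Qed.

Lemma cos_neq0 x : sin x = 0 -> cos x != 0.
Proof.
move=> h; apply: contra_eq_neq (cos2Dsin2 x) => hc.
by rewrite h hc expr0n addr0 eq_sym oner_eq0.
Qed.

Lemma sin_acot c : 0 < sin (acot c).
Proof.
rewrite /acot addrC sinDpihalf cosN cos_gt0_pihalf //.
by rewrite atan_gtNpi2 atan_ltpi2.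
Qed.

Lemma acotK c : cot (acot c) = c.
Proof.
rewrite /cot /acot addrC sinDpihalf cosDpihalf cosN sinN opprK.
exact: (atanK c).
Qed.

Lemma acot_gt0 c : 0 < acot c.
Proof. by rewrite subr_gt0 atan_ltpi2. Qed.

Lemma acot_ltpi c : acot c < pi.
Proof. by have := atan_gtNpi2 c; rewrite /acot; lra. Qed.

Lemma cotK x : 0 < x < pi -> acot (cot x) = x.
Proof.
move=> /andP[h1 h2]; rewrite /acot.
have -> : cot x = tan (pi / 2 - x).
  by rewrite /tan /cot addrC sinDpihalf cosDpihalf cosN sinN opprK.
rewrite tanK; first lra.
by rewrite in_itv /=; apply/andP; split; lra.
Qed.

Lemma le_acot : {homo acot : x y /~ x <= y}.
Proof. by move=> x y h; rewrite lerD2l lerN2 le_atan. Qed.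

Lemma cotD x n : cot (x + pi * n%:~R) = cot x.
Proof.
have hs := sin_pi_int n; have hc := cos_neq0 hs.
rewrite /cot sinD cosD hs !mulr0 addr0 subr0.
by rewrite -mulf_div divff // mulr1.
Qed.

Lemma sin_piD x n : (sin (x + pi * n%:~R) == 0) = (sin x == 0).
Proof.
have hs := sin_pi_int n; have hc := cos_neq0 hs.
by rewrite sinD hs mulr0 addr0 mulf_eq0 (negPf hc) orbF.
Qed.

Lemma sin_eq0 x : (sin x == 0) = (x == pi * (wind x)%:~R).
Proof.
apply/idP/idP => [|/eqP->]; last by rewrite sin_pi_int.
apply: contraLR => hx; have /andP[h1 h2] := wind_itv x.
have -> : x = x - pi * (wind x)%:~R + pi * (wind x)%:~R by rewrite subrK.
rewrite sin_piD gt_eqF // sin_gt0_pi //.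
by rewrite subr_gt0 lt_neqAle eq_sym hx h1 /= ltrBlDl.
Qed.

(** Half turns and cotangent are coordinates for an angle that is not a multiple of pi; comparisons
    of angles split into these two. *)
Lemma angleE x : sin x != 0 -> x = pi * (wind x)%:~R + acot (cot x).
Proof.
move=> hs; have /andP[h1 h2] := wind_itv x.
have e : x = (x - pi * (wind x)%:~R) + pi * (wind x)%:~R by rewrite subrK.
rewrite {3}e cotD cotK; first by rewrite addrC subrK.
by rewrite subr_gt0 lt_neqAle eq_sym -sin_eq0 hs h1 ltrBlDl.
Qed.

Lemma le_cot x y : sin x != 0 -> sin y != 0 -> wind x = wind y -> x <= y ->
  cot y <= cot x.
Proof.
move=> /angleE hx /angleE hy e; apply: contraTT; rewrite -!ltNge => /lt_atan h.
by rewrite hx hy e ltrD2l ltrD2l ltrN2.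
Qed.

Section Junction.
Variables (I : finType).
Implicit Types (A : pred I) (t u : I -> R).

(* The angle seen above a vertex whose branches arrive with angles [t i]: the
   logarithmic derivatives [cot (t i)] add up, and so do the numbers of half
   turns already made. When some branch function vanishes at the vertex,
   [cot] is infinite and the new angle is a multiple of pi. *)
Definition junction A t : R :=
  pi * (\sum_(i | A i) wind (t i))%:~R +
  (if [exists i, A i && (sin (t i) == 0)] then 0
   else acot (\sum_(i | A i) cot (t i))).

Lemma junction_itv A t (n := (\sum_(i | A i) wind (t i))%:~R : R) :
  pi * n <= junction A t < pi * n + pi.
Proof.
rewrite /junction; case: ifP => _; first by rewrite addr0 lexx ltrDl pi_gt0.
by rewrite lerDl ltrD2l (ltW (acot_gt0 _)) acot_ltpi.
Qed.

Lemma eq_junction A t u : (forall i, A i -> t i = u i) ->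
  junction A t = junction A u.
Proof.
move=> e; rewrite /junction (eq_bigr (wind \o u)) => [|i Ai]; last by rewrite /= e.
rewrite (eq_bigr (cot \o u)) => [|i Ai]; last by rewrite /= e.
rewrite (@eq_existsb _ _ (fun i => A i && (sin (u i) == 0))) // => i.
by case Ai : (A i) => //=; rewrite e.
Qed.

Lemma junctionD A t (d : I -> int) :
  junction A (fun i => t i + pi * (d i)%:~R) =
  junction A t + pi * (\sum_(i | A i) d i)%:~R.
Proof.
rewrite /junction (eq_bigr (fun i => wind (t i) + d i)) => [|i _]; last first.
  by rewrite windD.
rewrite big_split /= intrD mulrDr addrAC; congr (_ + _ + _).
rewrite (@eq_existsb _ _ (fun i => A i && (sin (t i) == 0))) => [|i]; last first.
  by rewrite sin_piD.
by under eq_bigr do rewrite cotD.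
Qed.

Lemma junction_nodal A t i : A i -> sin (t i) = 0 -> sin (junction A t) = 0.
Proof.
move=> Ai si; rewrite /junction ifT ?addr0 ?sin_pi_int //.
by apply/existsP; exists i; rewrite Ai si eqxx.
Qed.

Lemma junction_cot A t : (forall i, A i -> sin (t i) != 0) ->
  sin (junction A t) != 0 /\ cot (junction A t) = \sum_(i | A i) cot (t i).
Proof.
move=> h; rewrite /junction ifF; last first.
  by apply/negbTE/existsPn => i; case Ai : (A i); rewrite /= ?h.
by rewrite addrC sin_piD gt_eqF ?sin_acot // cotD acotK.
Qed.

Lemma junction_ge0 A t : (forall i, A i -> 0 <= t i) -> 0 <= junction A t.
Proof.
move=> h; have /andP[+ _] := junction_itv A t; apply: le_trans.
rewrite mulr_ge0 ?pi_ge0 // ler0z sumr_ge0 // => i /h ti.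
by rewrite /wind floor_ge0 divr_ge0 ?pi_ge0.
Qed.

Lemma junction0 A i : A i -> junction A (fun=> 0) = 0.
Proof.
move=> Ai; rewrite /junction ifT; last first.
  by apply/existsP; exists i; rewrite Ai sin0 eqxx.
by rewrite big1 ?mulr0 ?addr0 // => j _; rewrite /wind mul0r floor0.
Qed.

(** All values with a given total of half turns lie within one half turn, so an increase of any
    [wind] settles the matter. If none increases, the cotangents do not increase, and a nodal [u i]
    forces [t i] to be nodal too. *)
Lemma le_junction A t u : (forall i, A i -> t i <= u i) ->
  junction A t <= junction A u.
Proof.
move=> le_tu.
have le_w i : A i -> wind (t i) <= wind (u i) by move=> /le_tu /le_wind.
have [/eqP e|ne] := boolP (\sum_(i | A i) wind (t i) == \sum_(i | A i) wind (u i)).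
  have ew i : A i -> wind (t i) = wind (u i).
    move=> Ai; have : \sum_(i | A i) (wind (u i) - wind (t i)) == 0.
      by rewrite sumrB e subrr.
    rewrite psumr_eq0 => [/allP/(_ i)|k Ak]; last by rewrite subr_ge0 le_w.
    by rewrite mem_index_enum Ai subr_eq0 => /(_ isT)/eqP.
  rewrite /junction e lerD2l; case: ifPn => [_|/existsPn ht].
    by case: ifP => // _; rewrite ltW // acot_gt0.
  case: ifPn => [/existsP[i /andP[Ai ui]]|/existsPn hu].
    have := ht i; rewrite Ai /= sin_eq0 => /eqP[].
    apply/le_anti; have /andP[-> _] := wind_itv (t i); rewrite andbT ew //.
    by apply: (le_trans (le_tu i Ai)); rewrite le_eqVlt -sin_eq0 ui.
  apply: le_acot; apply: ler_sum => i Ai.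
  by apply: le_cot; rewrite ?le_tu ?ew //;
    [have := ht i|have := hu i]; rewrite Ai.
have lts : \sum_(i | A i) wind (t i) + 1 <= \sum_(i | A i) wind (u i).
  by rewrite lezD1 lt_neqAle ne ler_sum.
have /andP[_ /ltW h1] := junction_itv A t.
have /andP[h2 _] := junction_itv A u.
apply: (le_trans h1); apply: le_trans h2.
by rewrite -{2}[pi]mulr1 -mulrDr ler_pM2l ?pi_gt0 // -[X in _ + X]/(1%:~R) -intrD ler_int.
Qed.

Definition nodal_count A t := #|[pred i | A i && (sin (t i) == 0)]|.

(** Each branch with [u i] a multiple of pi completes a half turn strictly after [t i]. These half
    turns all count except one, since the remainder of a combined angle may be anything below pi.
    The truncated predecessor also covers the case of no nodal branch. *)
Lemma junction_strict A t u : (forall i, A i -> t i < u i) ->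
  junction A t <= junction A u - pi * (nodal_count A u).-1%:R.
Proof.
move=> lt_tu; rewrite /nodal_count.
set m := #|_|; have [m0|m0] := posnP m.
  by rewrite m0 mulr0 subr0 le_junction // => i /lt_tu/ltW.
have : \sum_(i | A i) wind (t i) + m%:Z <= \sum_(i | A i) wind (u i).
  have -> : m = (\sum_(i | A i) (sin (u i) == 0%R))%N.
    by rewrite /m -sum1_card [RHS]big_mkcond [LHS]big_mkcond; apply: eq_bigr => i _;
      rewrite inE; case: (A i) => //=; case: eqP.
  rewrite -[_%:Z]natz natr_sum -big_split ler_sum // => i Ai /=.
  case: eqP => [/eqP|_]; last by rewrite addr0 le_wind // ltW // lt_tu.
  rewrite sin_eq0 => /eqP ui; rewrite lezD1 -(ltr_int R) -(ltr_pM2l (pi_gt0 R)).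
  rewrite -ui; apply: le_lt_trans (lt_tu i Ai).
  by have /andP[] := wind_itv (t i).
rewrite -(ler_int R) -(ler_pM2l (pi_gt0 R)) intrD mulrDr => h.
have /andP[_ /ltW h1] := junction_itv A t.
have /andP[h2 _] := junction_itv A u.
have e : (m%:Z)%:~R = m.-1%:R + 1 :> R by rewrite natr1 prednK.
move: h; rewrite e mulrDr mulr1 => h.
by rewrite lerBrDr; lra.
Qed.

End Junction.
End Angles.

(** * Doubling the angles at a vertex *)

Section JunctionDouble.
Variables (R : realType) (I : finType).
Implicit Types (A : pred I) (t u : I -> R).

Lemma cot_double (x : R) : sin x != 0 -> cot x != 0 ->
  sin (2 * x) != 0 /\ cot (2 * x) = (cot x - (cot x)^-1) / 2.
Proof.
move=> hs hc.
have hc' : cos x != 0 by apply: contra_neq hc => e; rewrite /cot e mul0r.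
rewrite mulrC mulr_natr sin_mulr2n; split.
  by rewrite mulrn_eq0 /= mulf_neq0.
rewrite /cot cos_mulr2n sin_mulr2n -mulr_natr -[X in _ / X]mulr_natr.
rewrite (_ : cos x ^+ 2 * 2 - 1 = cos x ^+ 2 - sin x ^+ 2); last first.
  by rewrite sin2cos2; ring.
by field; rewrite hs hc'.
Qed.

Lemma wind_ge (x : R) n : (n <= wind x) = (pi * n%:~R <= x).
Proof. by rewrite floor_ge_int ler_pdivlMr ?pi_gt0 // mulrC. Qed.

Lemma wind_double (x : R) : 2 * wind x <= wind (2 * x).
Proof.
have /andP[h1 h2] := wind_itv x.
by rewrite wind_ge intrM mulrCA ler_pM2l.
Qed.

(** A nonpositive cotangent means that the current half turn is at least half completed, so doubling
    yields an extra one. *)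
Lemma wind_doubleS (x : R) : sin x != 0 -> cot x <= 0 -> 2 * wind x + 1 <= wind (2 * x).
Proof.
move=> hs hc; rewrite wind_ge intrD1 intrM mulrDr mulr1.
have := angleE hs; have : pi / 2 <= acot (cot x).
  by have := le_atan hc; rewrite atan0 /acot; lra.
by lra.
Qed.

(** The expression in [c] on the right is the cotangent of the doubled angle, and the boolean
    records whether doubling passes pi. *)
Lemma acot_double (c : R) : c != 0 ->
  2 * acot c = pi * (c < 0)%R%:R + acot ((c - c^-1) / 2).
Proof.
move=> c0; have hs := lt0r_neq0 (sin_acot c).
have := cot_double hs; rewrite acotK => /(_ c0) [s2 e2].
rewrite -e2 {1}(angleE s2); congr (pi * _ + _).
have [g0 l0] := (acot_gt0 c, acot_ltpi c).
rewrite -[RHS]/((c < 0)%R%:Z%:~R); congr _%:~R; apply: wind_eq.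
case: ltrgt0P c0 => // hc _; have := lt_atan hc; rewrite atan0 /= => h;
  move: g0 l0; rewrite /acot => g0 l0; apply/andP; split; lra.
Qed.

(** A single reciprocal suffices: 1 / C <= 1 / c i for any i, since c i <= C. *)
Lemma sum_subr_inv_le A (c : I -> R) (C := \sum_(i | A i) c i) :
  (forall i, A i -> 0 < c i) -> (exists i, A i) ->
  \sum_(i | A i) (c i - (c i)^-1) / 2 <= (C - C^-1) / 2.
Proof.
move=> c0 [i Ai]; rewrite -mulr_suml ler_pM2r ?invr_gt0 // sumrB lerD2l lerN2.
rewrite (bigD1 i) //=; apply: le_trans (_ : (c i)^-1 <= _); last first.
  by rewrite lerDl sumr_ge0 // => j /andP[/c0 cj _]; rewrite invr_ge0 ltW.
rewrite lef_pV2 ?posrE ?c0 //.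
  by rewrite /C (bigD1 i) //= lerDl sumr_ge0 // => j /andP[/c0/ltW].
by rewrite /C (bigD1 i) //= ltr_wpDr ?c0 // sumr_ge0 // => j /andP[/c0/ltW].
Qed.

(** Here c i <= C < 0 gives 1 / C <= 1 / c i, and the other reciprocals are positive. *)
Lemma sum_subr_inv_le_neg A (c : I -> R) i (C := \sum_(j | A j) c j) :
  A i -> (forall j, A j -> j != i -> 0 < c j) -> C < 0 ->
  \sum_(i | A i) (c i - (c i)^-1) / 2 <= (C - C^-1) / 2.
Proof.
move=> Ai c0 C0; rewrite -mulr_suml ler_pM2r ?invr_gt0 // sumrB lerD2l lerN2.
have le_iC : c i <= C.
  by rewrite /C (bigD1 i) //= lerDl sumr_ge0 // => j /andP[Aj /c0] /(_ Aj)/ltW.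
rewrite (bigD1 i) //=; apply: le_trans (_ : (c i)^-1 <= _); last first.
  by rewrite lerDl sumr_ge0 // => j /andP[Aj /c0] /(_ Aj) cj; rewrite invr_ge0 ltW.
by rewrite lef_nV2 ?negrE // (le_lt_trans le_iC).
Qed.

(* [1 / C <= \sum_i 1 / c i] handles all non-nodal cases except those in which
   at least two of the angles, or one of them but not their combination, pass an
   odd multiple of pi / 2: there the extra half turns suffice. *)
Lemma junction_double A t : (exists i, A i) ->
  2 * junction A t <= junction A (fun i => 2 * t i).
Proof.
move=> A0; set S : int := \sum_(i | A i) wind (t i).
have /andP[lo _] := junction_itv A (fun i => 2 * t i).
have pi0 := pi_gt0 R.
have lo' (n : int) : 2 * S + n <= \sum_(i | A i) wind (2 * t i) ->
    2 * (pi * S%:~R) + pi * n%:~R <= junction A (fun i => 2 * t i).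
  move=> h; apply: le_trans lo; rewrite mulrCA -mulrDr ler_pM2l //.
  by rewrite -[2]/(2%:~R) -intrM -intrD ler_int.
have le2S : 2 * S + 0 <= \sum_(i | A i) wind (2 * t i).
  by rewrite addr0 mulr_sumr ler_sum // => i _; apply: wind_double.
have [/existsP[i /andP[Ai /eqP ti]]|/existsPn nod] :=
    boolP [exists i, A i && (sin (t i) == 0)].
  apply: le_trans (lo' 0 le2S); rewrite mulr0 addr0 ler_pM2l //.
  rewrite /junction ifT ?addr0 //; by apply/existsP; exists i; rewrite Ai ti eqxx.
have {}nod i : A i -> sin (t i) != 0 by move=> Ai; have := nod i; rewrite Ai.
set C := \sum_(i | A i) cot (t i).
have -> : junction A t = pi * S%:~R + acot C.
  rewrite /junction ifF //; apply/negbTE/existsPn => i.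
  by case Ai : (A i); rewrite //= nod.
have le2S1 i : A i -> cot (t i) <= 0 -> 2 * S + 1 <= \sum_(i | A i) wind (2 * t i).
  move=> Ai ci; rewrite mulr_sumr (bigD1 i) //= [leRHS](bigD1 i) //= addrAC.
  by rewrite lerD ?wind_doubleS ?nod ?ler_sum // => j _; apply: wind_double.
(* The two main cases, all cotangents positive or exactly one nonpositive with [C < 0], share this
   comparison: half turns and cotangents are doubled separately, and the half turn gained by
   [acot C] for negative [C] must be found among the branches. *)
have split2 : (forall i, A i -> cot (t i) != 0) ->
    \sum_(i | A i) (cot (t i) - (cot (t i))^-1) / 2 <= (C - C^-1) / 2 ->
    2 * S + (C < 0)%R%:Z <= \sum_(i | A i) wind (2 * t i) -> C != 0 ->
    2 * (pi * S%:~R + acot C) <= junction A (fun i => 2 * t i).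
  move=> c0 leC leS C0; rewrite mulrDr acot_double // addrA.
  rewrite /junction ifF; last first.
    apply/negbTE/existsPn => i; case Ai : (A i) => //=.
    by have [] := cot_double (nod i Ai) (c0 i Ai).
  rewrite mulrCA -mulrDr -[2]/(2%:~R) -intrM -[(C < 0)%R%:R]/((C < 0)%R%:Z%:~R) -intrD.
  rewrite lerD //; first by rewrite ler_pM2l // ler_int.
  apply: le_acot; rewrite (eq_bigr (fun i => (cot (t i) - (cot (t i))^-1) / 2)) // => i Ai.
  by have [] := cot_double (nod i Ai) (c0 i Ai).
have [/existsP[i /andP[Ai ci]]|/existsPn cpos] :=
    boolP [exists i, A i && (cot (t i) <= 0)]; last first.
  have {}cpos i : A i -> 0 < cot (t i) by move=> Ai; have := cpos i; rewrite Ai /= -ltNge.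
  have C0 : 0 < C.
    case: A0 => i Ai; rewrite /C (bigD1 i) //= ltr_wpDr ?cpos // sumr_ge0 //.
    by move=> j /andP[/cpos/ltW].
  apply: split2 => [i Ai|||].
  - by rewrite lt0r_neq0 // cpos.
  - exact: sum_subr_inv_le.
  - by rewrite (lt_gtF C0).
  - exact: lt0r_neq0.
have [C0|C0] := leP 0 C.
  apply: le_trans (lo' 1 (le2S1 i Ai ci)); rewrite mulrDr lerD2l mulr1.
  by have := le_atan C0; rewrite atan0 /acot; lra.
have [/existsP[j /and3P[Aj ji cj]]|/existsPn cpos] :=
    boolP [exists j, [&& A j, j != i & cot (t j) <= 0]].
  apply: le_trans (lo' 2 _).
    by rewrite mulrDr lerD2l mulrC ler_pM2r // ltW // acot_ltpi.
  rewrite mulr_sumr (bigD1 i) //= (bigD1 j) ?Aj //=.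
  rewrite [leRHS](bigD1 i) //= [in leRHS](bigD1 j) ?Aj //=.
  rewrite (_ : _ + 2 = 2 * wind (t i) + 1 + (2 * wind (t j) + 1 +
    \sum_(k | A k && (k != i) && (k != j)) 2 * wind (t k))); last by ring.
  rewrite lerD ?wind_doubleS ?nod // lerD ?wind_doubleS ?nod //.
  by apply: ler_sum => k _; apply: wind_double.
have {}cpos j : A j -> j != i -> 0 < cot (t j).
  by move=> Aj ji; have := cpos j; rewrite Aj ji /= -ltNge.
have ci0 : cot (t i) < 0.
  apply: le_lt_trans C0; rewrite /C (bigD1 i) //= lerDl sumr_ge0 //.
  by move=> j /andP[Aj /(cpos _ Aj)/ltW].
apply: split2 => [j Aj|||].
- have [->|ji] := eqVneq j i; first by rewrite ltr0_neq0.
  by rewrite lt0r_neq0 // cpos.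
- exact: sum_subr_inv_le_neg Ai cpos C0.
- by rewrite C0; apply: le2S1 Ai ci.
- exact: ltr0_neq0.
Qed.

End JunctionDouble.

(** * One-sided limits of the combined angle *)

Section JunctionLimits.
Variables (R : realType) (I : finType).
Implicit Types (A : pred I) (t u : I -> R).

Lemma acot_lt (c d : R) : acot c < acot d -> d < c.
Proof.
rewrite /acot ltrD2l ltrN2; apply: contraTT; rewrite -!leNgt; exact: le_atan.
Qed.

(** The hypothesis treats two cases at once: it holds for every [K] at a multiple of pi, where the
    cotangent tends to +oo from the right, and elsewhere it says [K < cot x]. *)
Lemma near_cot (x K : R) : x < pi * (wind x)%:~R + acot K ->
  \forall d \near 0^'+, wind (x + d) = wind x /\ (sin (x + d) != 0 /\ K <= cot (x + d)).
Proof.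
move=> ltx; near=> d.
have d0 : 0 < d by [].
have dK : d < pi * (wind x)%:~R + acot K - x.
  by near: d; apply: nbhs_right_lt; rewrite subr_gt0.
have /andP[h1 h2] := wind_itv x; have lpi := acot_ltpi K.
have ew : wind (x + d) = wind x by apply: wind_eq; apply/andP; split; lra.
have hs : sin (x + d) != 0 by rewrite sin_eq0 ew gt_eqF //; lra.
split=> //; split=> //; apply/ltW/acot_lt.
by have := angleE hs; rewrite ew; lra.
Unshelve. all: by end_near. Qed.

Lemma junction_right A t e : 0 < e ->
  exists2 d, 0 < d & junction A (fun i => t i + d) <= junction A t + e.
Proof.
move=> e0.
(* It suffices to bound cotangents from below after a small rotation: [K i] for each branch, [T] for
   their sum. *)
suff [K [T [Kt KT Te]]] : exists K : I -> R, exists T : R,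
    [/\ forall i, A i -> t i < pi * (wind (t i))%:~R + acot (K i),
        T <= \sum_(i | A i) K i &
        pi * (\sum_(i | A i) wind (t i))%:~R + acot T <= junction A t + e].
  have : \forall d \near 0^'+, forall i, A i -> wind (t i + d) = wind (t i) /\
      (sin (t i + d) != 0 /\ K i <= cot (t i + d)).
    apply: filter_forall => i; have [Ai|nAi] := boolP (A i); last by near=> d.
    by have := near_cot (Kt i Ai); apply: filterS.
  move=> H; have [d [d0 Hd]] := filter_ex (filterI (nbhs_right_gt 0) H).
  exists d => //; apply: le_trans Te; rewrite /junction ifF; last first.
    by apply/negbTE/existsPn => i; case Ai : (A i); rewrite //=; have [_ []] := Hd i Ai.
  rewrite (eq_bigr (fun i => wind (t i))) => [|i Ai]; last by have [] := Hd i Ai.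
  rewrite lerD2l le_acot // (le_trans KT) // ler_sum // => i Ai.
  by have [_ []] := Hd i Ai.
have [/existsP[i0 /andP[Ai0 /eqP ti0]]|/existsPn nod] :=
    boolP [exists i, A i && (sin (t i) == 0)].
  (* The target angle is [m]. A nodal branch can supply an arbitrarily large cotangent, so it
     absorbs both [cot m] and the total [B] of the others. *)
  pose B := \sum_(i | A i) `|cot (t i) - 1|.
  pose m := Num.min e (pi / 2).
  have m0 : 0 < m by rewrite lt_min e0 divr_gt0 ?pi_gt0.
  have mpi : 0 < m < pi.
    by rewrite m0 /= gt_min; apply/orP; right; have := pi_gt0 R; lra.
  exists (fun i => if sin (t i) == 0 then `|cot m| + B else cot (t i) - 1), (cot m).
  split.
  - move=> i Ai; case: ifPn => [|ns].
      by rewrite sin_eq0 => /eqP <-; rewrite ltrDl acot_gt0.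
    rewrite {1}(angleE ns) ltrD2l /acot ltrD2l ltrN2 lt_atan //.
    by rewrite gtrBl.
  - rewrite (bigD1 i0) //= ti0 eqxx.
    have : - B <= \sum_(i | A i && (i != i0))
        (if sin (t i) == 0 then `|cot m| + B else cot (t i) - 1).
      have B0 : 0 <= B by apply: sumr_ge0.
      apply: (@le_trans _ _ (- \sum_(i | A i && (i != i0)) `|cot (t i) - 1|)).
        by rewrite lerN2 /B [leRHS](bigD1 i0) //= lerDr.
      rewrite -sumrN; apply: ler_sum => i _; case: ifP => _.
        by rewrite (le_trans (_ : _ <= 0)) ?oppr_le0 // addr_ge0.
      by rewrite lerNl -normrN ler_norm.
    by have := ler_norm (cot m); lra.
  - rewrite cotK // /junction ifT; last first.
      by apply/existsP; exists i0; rewrite Ai0 ti0 eqxx.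
    by rewrite addr0 lerD2l ge_min lexx.
have {}nod i : A i -> sin (t i) != 0 by move=> Ai; have := nod i; rewrite Ai.
pose C := \sum_(i | A i) cot (t i).
have [lC gC] := (acot_gt0 C, acot_ltpi C).
(* Half the distance to pi keeps the target [acot C + m] inside ]0, pi[. The loss of cotangent that
   it permits is shared among the branches; [#|I|.+1] is nonzero even for empty [I]. *)
pose m := Num.min e ((pi - acot C) / 2).
have m0 : 0 < m by rewrite lt_min e0 divr_gt0 // subr_gt0.
have mpi : 0 < acot C + m < pi.
  rewrite addr_gt0 //=; have : m <= (pi - acot C) / 2 by rewrite ge_min lexx orbT.
  by lra.
have ltT : cot (acot C + m) < C by apply: acot_lt; rewrite cotK // ltrDl.
pose eta := (C - cot (acot C + m)) / #|I|.+1%:R.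
have eta0 : 0 < eta by rewrite divr_gt0 // subr_gt0.
exists (fun i => cot (t i) - eta), (cot (acot C + m)); split.
- move=> i Ai; rewrite {1}(angleE (nod i Ai)) ltrD2l /acot ltrD2l ltrN2.
  by rewrite lt_atan // gtrBl.
- rewrite sumrB -/C lerBrDr -lerBrDl sumr_const -[leRHS](@divfK _ #|I|.+1%:R) //.
  by rewrite -/eta -[X in X <= _]mulr_natr ler_pM2l // ler_nat ltnW // ltnS max_card.
- rewrite cotK // /junction ifF; last first.
    by apply/negbTE/existsPn => i; case Ai : (A i); rewrite //= nod.
  by rewrite -/C addrA lerD2l ge_min lexx.
Unshelve. all: by end_near. Qed.

Lemma windN (x : R) : wind (- x) = - wind x - (sin x != 0)%:Z.
Proof.
apply: wind_eq; have /andP[h1 h2] := wind_itv x; have := pi_gt0 R.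
case: eqP => [/eqP|/eqP]; rewrite sin_eq0 => hx /=.
  by rewrite subr0 intrN mulrN; move: (eqP hx) => ex hpi; lra.
have : pi * (wind x)%:~R < x by rewrite lt_neqAle eq_sym hx h1.
by rewrite intrD !intrN; lra.
Qed.

Lemma acotN (c : R) : acot (- c) = pi - acot c.
Proof. by rewrite /acot atanN; lra. Qed.

(* Reversing the angles exchanges left and right limits. *)
Lemma junctionN A t : (exists i, A i) ->
  junction A (fun i => - t i) =
  pi * (nodal_count A t).-1%:R - pi * #|A|.-1%:R - junction A t.
Proof.
move=> [i0 Ai0]; set m := nodal_count A t.
have cardA : #|A|%:R = #|A|.-1%:R + 1 :> R.
  by rewrite natr1 prednK //; apply/card_gt0P; exists i0.
have sumN : (\sum_(i | A i) wind (- t i))%:~R =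
    - (\sum_(i | A i) wind (t i))%:~R - #|A|%:R + m%:R :> R.
  have : \sum_(i | A i) wind (- t i) =
      - (\sum_(i | A i) wind (t i)) - #|A|%:R + m%:R :> int.
    have -> : m = (\sum_(i | A i) (sin (t i) == 0%R))%N.
      by rewrite /m /nodal_count -sum1_card [RHS]big_mkcond [LHS]big_mkcond;
        apply: eq_bigr => i _; rewrite inE; case: (A i) => //=; case: eqP.
    rewrite -sumr_const natr_sum -sumrN -!sumrB -big_split /=.
    apply: eq_bigr => i _; rewrite windN; case: eqP => //=; lia.
  by move=> ->; rewrite intrD intrB intrN !rmorph_nat.
have eN : [exists i, A i && (sin (- t i) == 0)] = [exists i, A i && (sin (t i) == 0)].
  by apply: eq_existsb => i; rewrite sinN oppr_eq0.
rewrite /junction sumN eN; case: ifPn => [/existsP[i Pi]|/existsPn nod].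
  have : m%:R = m.-1%:R + 1 :> R.
    by rewrite natr1 prednK //; apply/card_gt0P; exists i.
  by rewrite cardA => ->; ring.
have -> : m = 0%N by apply: eq_card0 => i; apply/negbTE/nod.
rewrite (eq_bigr (fun i => - cot (t i))) => [|i _]; last first.
  by rewrite /cot sinN cosN invrN mulrN.
by rewrite sumrN acotN cardA /=; ring.
Qed.

(** Right continuity at the reversed angles; the nodal count at the moved angles enters with the
    favourable sign. *)
Lemma junction_left A t e : (exists i, A i) -> 0 < e ->
  exists2 d, 0 < d &
    junction A t - pi * (nodal_count A t).-1%:R - e <= junction A (fun i => t i - d).
Proof.
move=> A0 /(junction_right A (fun i => - t i))[d d0 hd]; exists d => //.
move: hd; rewrite (@eq_junction _ _ _ _ (fun i => - (t i - d))) => [|i _]; last first.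
  by rewrite opprB addrC.
rewrite !junctionN //; set m := (nodal_count A (fun i => t i - d)).-1.
have : 0 <= pi * m%:R :> R by rewrite mulr_ge0 ?pi_ge0.
by lra.
Qed.

End JunctionLimits.

(** * Linear systems *)

Section LinearAlgebra.
Variable R : realType.

Lemma linear_inj_surj (E : finType) (L : (E -> R) -> E -> R) :
  (forall k s t c, L (fun e => k * s e + t e) c = k * L s c + L t c) ->
  (forall t, (forall c, L t c = 0) -> forall e, t e = 0) ->
  forall y, exists t, forall c, L t c = y c.
Proof.
move=> linL injL y.
pose f (x : {ffun E -> R^o}) : {ffun E -> R^o} := [ffun c => L x c].
have linf : linear f.
  move=> k s t; apply/ffunP => c; rewrite !ffunE -linL; congr (L _ c).
  by apply/funext => e; rewrite !ffunE.
pose lf : {linear {ffun E -> R^o} -> {ffun E -> R^o}} :=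
  HB.pack f (GRing.isLinear.Build _ _ _ _ f linf).
have ker0 : lker (linfun lf) == 0%VS.
  rewrite -subv0; apply/subvP => t; rewrite memv_ker memv0 lfunE /= => /eqP ft.
  apply/eqP/ffunP => e; rewrite [RHS]ffunE; apply: injL => c.
  by have := congr1 (fun g : {ffun E -> R^o} => g c) ft; rewrite !ffunE.

exists ((linfun lf)^-1%VF (finfun y)) => c.
have := congr1 (fun g : {ffun E -> R^o} => g c) (lker0_lfunVK ker0 (finfun y)).
by rewrite lfunE /= !ffunE.
Qed.

(** Serves to bound the size of an independent family of eigenfunctions by the number of edges whose
    amplitudes determine an eigenfunction. *)
Lemma exists_dependency (I E : finType) (A : {pred I}) (F : {pred E}) (y : I -> E -> R) :
  (#|F| < #|A|)%N ->
  exists c : I -> R, [/\ forall i, i \notin A -> c i = 0, exists i, c i != 0 &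
    forall e, e \in F -> \sum_i c i * y i e = 0].
Proof.
move=> ltFA; pose Y : 'M[R]_(#|A|, #|F|) := \matrix_(i, j) y (enum_val i) (enum_val j).
have /rowV0Pn[v /sub_kermxP vY v0] : kermx Y != 0.
  rewrite -mxrank_eq0 mxrank_ker subn_eq0 -ltnNge.
  exact: leq_ltn_trans (rank_leq_col Y) ltFA.
(* A vector of the left kernel, extended by 0 outside [A]. *)
exists (fun i => \sum_k (enum_val k == i)%:R * v 0 k); split.
- move=> i nAi; rewrite big1 // => k _; case: eqP => [e|_]; last by rewrite mul0r.
  by rewrite -e enum_valP in nAi.
- have /rV0Pn[k vk] := v0; exists (enum_val k).
  rewrite (bigD1 k) //= eqxx mul1r big1 ?addr0 // => j jk.
  by rewrite (inj_eq enum_val_inj) (negPf jk) mul0r.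
move=> e Fe; under eq_bigr do rewrite mulr_suml.
rewrite exchange_big /=.
have := congr1 (fun M : 'rV_#|F| => M 0 (enum_rank_in Fe e)) vY.
rewrite [RHS]mxE mxE => vY0; rewrite -[RHS]vY0; apply: eq_bigr => k _.
rewrite mxE enum_rankK_in //.
rewrite (bigD1 (enum_val k)) //= eqxx mul1r big1 ?addr0 // => i ik.
by rewrite eq_sym (negPf ik) !mul0r.
Qed.

End LinearAlgebra.

(** * The recursion on a rooted tree *)

Section RootedTree.
Variables (E V : finType) (bot top : E -> V) (r : V) (depth : V -> nat) (e0 : E).
Hypothesis depth_top : forall e, (depth (top e) < depth (bot e))%N.
Hypothesis bot_inj : injective bot.
Hypothesis bot_surj : forall v, v != r -> exists e, bot e = v.
Hypothesis bot_root : forall e, bot e != r.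
Hypothesis top_root : forall e, (top e == r) = (e == e0).

Definition is_child (e c : E) := top c == bot e.

(** A measure that decreases towards the leaves, for recursion from the leaves upwards. *)
Definition height e := (\max_v depth v - depth (bot e))%N.

Lemma height_child e c : is_child e c -> (height c < height e)%N.
Proof.
move=> /eqP tc; have := depth_top c; rewrite tc /height.
by have := leq_bigmax (F := depth) (bot c); lia.
Qed.

Lemma bottom_up_ind (P : E -> Prop) :
  (forall e, (forall c, is_child e c -> P c) -> P e) -> forall e, P e.
Proof.
move=> IH e; have [n] := ubnP (height e).
elim: n e => // n IHn e le_n; apply: IH => c /height_child lt_c; apply: IHn.
exact: leq_trans lt_c le_n.
Qed.

Lemma top_down_ind (P : E -> Prop) :
  P e0 -> (forall p c, is_child p c -> P p -> P c) -> forall e, P e.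
Proof.
move=> P0 IH e; have [n] := ubnP (depth (bot e)).
elim: n e => // n IHn e le_n; have [er|er] := eqVneq (top e) r.
  by move/eqP: er; rewrite top_root => /eqP->.
have [p ep] := bot_surj er; apply: (IH p); first by rewrite /is_child ep.
by apply: IHn; rewrite ep (leq_trans (depth_top e)).
Qed.

(** Iterating [step] from a constant function stabilises: the value at [e] is final once the number
    of iterations exceeds [height e]. *)
Lemma tree_rec (T : Type) (step : E -> (E -> T) -> T) (x : T) :
  (forall e f g, (forall c, is_child e c -> f c = g c) -> step e f = step e g) ->
  exists f : E -> T, forall e, f e = step e f.
Proof.
move=> ext; pose f n := iter n (fun f e => step e f) (fun=> x).
have fE n m e : (height e < n)%N -> (height e < m)%N -> f n e = f m e.
  elim: n m e => // n IHn [//|m] e; rewrite !ltnS => hn hm /=.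
  by apply: ext => c /height_child hc; apply: IHn; apply: leq_trans hc _.
exists (fun e => f (height e).+1 e) => e; rewrite {1}/f iterS; apply: ext => c /height_child hc.
exact: fE.
Qed.

(** Every edge except [e0] is the child of exactly one edge, the one whose lower vertex is its upper
    vertex. *)
Lemma sum_child (M : nmodType) (F : E -> M) :
  \sum_e F e = F e0 + \sum_e \sum_(c | is_child e c) F c.
Proof.
rewrite (exchange_big_dep xpredT) //= (bigD1 e0) //=; congr (_ + _).
rewrite [RHS](bigD1 e0) //= [X in _ = X + _]big_pred0 => [|e]; last first.
  have /eqP e0r : top e0 == r by rewrite top_root.
  by rewrite /is_child e0r eq_sym (negPf (bot_root e)).
rewrite add0r; apply: eq_bigr => c; rewrite -top_root => /bot_surj[p pc].
rewrite (big_pred1 p) // => e; rewrite /is_child -pc.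
by rewrite (inj_eq bot_inj) eq_sym.
Qed.

(** * The angle as a function of frequency and edge *)

Section Angle.
Variables (R : realType) (l : E -> R).
Hypothesis l_gt0 : forall e, 0 < l e.
Implicit Types (w : R) (e c : E).

(** At a leaf the empty junction would give [acot 0], that is pi / 2, the Neumann condition; the
    test puts the Dirichlet angle 0 there. *)
Lemma exists_angle : exists phi : R -> E -> R, forall w e, phi w e =
  if [exists c, is_child e c] then junction (is_child e) (fun c => phi w c + w * l c)
  else 0.
Proof.
have H w : exists f : E -> R, forall e, f e =
    if [exists c, is_child e c] then junction (is_child e) (fun c => f c + w * l c) else 0.
  apply: (tree_rec (step := fun e f => if [exists c, is_child e c] then
    junction (is_child e) (fun c => f c + w * l c) else 0) 0) => e f g fg.
  by case: ifP => // _; apply: eq_junction => c /fg ->.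
by exists (fun w => sval (cid (H w))) => w e; case: cid.
Qed.

Variable phi : R -> E -> R.
Hypothesis phiE : forall w e, phi w e =
  if [exists c, is_child e c] then junction (is_child e) (fun c => phi w c + w * l c)
  else 0.

Definition end_angle w e := phi w e + w * l e.

Lemma phi_junction w e : (exists c, is_child e c) ->
  phi w e = junction (is_child e) (end_angle w).
Proof. by move=> /existsP ex; rewrite phiE ex. Qed.

Lemma phi_leaf w e : ~ (exists c, is_child e c) -> phi w e = 0.
Proof.
move=> nex; rewrite phiE ifF //; apply/negbTE/existsPn => c.
by apply/negP => ec; apply: nex; exists c.
Qed.

Lemma phi_ge0 w e : 0 <= w -> 0 <= phi w e.
Proof.
move=> w0; elim/bottom_up_ind: e => e IH; rewrite phiE; case: ifP => // _.
by apply: junction_ge0 => c /IH hc; rewrite addr_ge0 // mulr_ge0 // ltW.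
Qed.

Lemma phi0 e : phi 0 e = 0.
Proof.
elim/bottom_up_ind: e => e IH; rewrite phiE; case: ifP => // /existsP[c ec].
rewrite (@eq_junction _ _ _ _ (fun=> 0)) ?(junction0 _ ec) // => i /IH ->.
by rewrite mul0r addr0.
Qed.

Lemma phi_double w e : 2 * phi w e <= phi (2 * w) e.
Proof.
elim/bottom_up_ind: e => e IH; rewrite !phiE; case: ifP => [/existsP ex|_]; last first.
  by rewrite mulr0.
apply: (le_trans (junction_double _ ex)); apply: le_junction => c /IH.
by rewrite mulrDr mulrA lerD2r.
Qed.

(* The jump at [w], in multiples of pi, created at the lower vertex of [e]. *)
Definition excess w e := (nodal_count (is_child e) (end_angle w)).-1.

(** [D e] collects the excess over [e] and all edges below it; pi times it is the jump of the angle
    of [e] at [w]. *)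
Lemma exists_excess_below w : exists D : E -> nat,
  forall e, D e = (\sum_(c | is_child e c) D c + excess w e)%N.
Proof.
apply: (tree_rec (step := fun e f => \sum_(c | is_child e c) f c + excess w e)%N 0%N).
by move=> e f g fg; rewrite (eq_bigr g).
Qed.

Lemma excess_below_root w (D : E -> nat) :
  (forall e, D e = (\sum_(c | is_child e c) D c + excess w e)%N) ->
  D e0 = (\sum_e excess w e)%N.
Proof.
move=> DE; have : (\sum_e D e = D e0 + \sum_e \sum_(c | is_child e c) D c)%N.
  exact: sum_child.
rewrite {1}(eq_bigr _ (fun e _ => DE e)) big_split /=; lia.
Qed.

Section Limits.
Variables (w : R) (D : E -> nat).
Hypothesis DE : forall e, D e = (\sum_(c | is_child e c) D c + excess w e)%N.

Lemma leaf_excess e : ~ (exists c, is_child e c) -> D e = 0%N.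
Proof.
move=> nex; rewrite DE big_pred0 => [|c]; last first.
  by apply/negP => ec; apply: nex; exists c.
rewrite /excess /nodal_count eq_card0 // => c; rewrite inE.
by case ec : (is_child e c) => //; case: nex; exists c.
Qed.

Lemma junctionD_nat e (u : E -> R) :
  junction (is_child e) (fun c => u c + pi * (D c)%:R) =
  junction (is_child e) u + pi * (D e)%:R - pi * (excess w e)%:R.
Proof.
have -> : (D e)%:R = (\sum_(c | is_child e c) (D c)%:Z)%:~R + (excess w e)%:R :> R.
  by rewrite DE natrD natr_sum rmorph_sum.
by rewrite mulrDr addrA addrK -junctionD.
Qed.

(** By induction the children's angles at [w'], even with [D c] half turns added, stay strictly
    below those at [w], because edges have positive length. [junction_strict] then adds the excess
    of [e]. *)
Lemma phi_strict w' e : w' < w -> phi w' e <= phi w e - pi * (D e)%:R.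
Proof.
move=> ww'; elim/bottom_up_ind: e => e IH.
have [ex|nex] := pselect (exists c, is_child e c); last first.
  by rewrite !phi_leaf // leaf_excess // mulr0 subr0.
rewrite !phi_junction // lerBrDr -lerBrDl.
have := junctionD_nat e (end_angle w'); rewrite addrAC => h.
have : junction (is_child e) (fun c => end_angle w' c + pi * (D c)%:R) <=
    junction (is_child e) (end_angle w) - pi * (excess w e)%:R.
  apply: junction_strict => c /IH hc; rewrite /end_angle.
  have := l_gt0 c; rewrite -(ltr_pM2r (l_gt0 c)) in ww'.
  by move: ww'; lra.
by rewrite h; lra.
Qed.

(** With [phi_strict], this identifies the left limit of the angle at [w] as
    [phi w e - pi * (D e)%:R]. *)
Lemma phi_left e eps : 0 < eps ->
  \forall w' \near w^'-, phi w e - pi * (D e)%:R - eps <= phi w' e.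
Proof.
elim/bottom_up_ind: e eps => e IH eps eps0.
have [ex|nex] := pselect (exists c, is_child e c); last first.
  near=> w'; rewrite !phi_leaf // leaf_excess // mulr0 subr0 sub0r oppr_le0.
  exact: ltW.
have [d d0 hd] := junction_left (end_angle w) ex eps0.
have : \forall w' \near w^'-, forall c, is_child e c ->
    end_angle w c - d <= end_angle w' c + pi * (D c)%:R.
  apply: filter_forall => c; have [ec|nec] := boolP (is_child e c); last by near=> w'.
  have d20 : 0 < d / 2 by rewrite divr_gt0.
  near=> w'; move=> _; rewrite /end_angle.
  have h1 : phi w c - pi * (D c)%:R - d / 2 <= phi w' c.
    by near: w'; apply: IH.
  have : w - d / 2 / l c < w'.
    by near: w'; apply: nbhs_left_gt; rewrite gtrBl divr_gt0.
  rewrite ltrBlDr -(ltr_pM2r (l_gt0 c)) mulrDl divfK ?gt_eqF //.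
  by lra.
apply: filterS => w' hw'; rewrite !phi_junction //.
have := le_junction hw'; rewrite junctionD_nat.
move: hd; rewrite -/(excess w e); set x := junction _ (fun i => end_angle w i - d).
by lra.
Unshelve. all: by end_near. Qed.

End Limits.

Lemma phi_right w e eps : 0 < eps ->
  \forall w' \near w^'+, phi w' e <= phi w e + eps.
Proof.
elim/bottom_up_ind: e eps => e IH eps eps0.
have [ex|nex] := pselect (exists c, is_child e c); last first.
  by near=> w'; rewrite !phi_leaf // add0r ltW.
have [d d0 hd] := junction_right (is_child e) (end_angle w) eps0.
have : \forall w' \near w^'+, forall c, is_child e c -> end_angle w' c <= end_angle w c + d.
  apply: filter_forall => c; have [ec|nec] := boolP (is_child e c); last by near=> w'.
  have d20 : 0 < d / 2 by rewrite divr_gt0.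
  near=> w'; move=> _; rewrite /end_angle.
  have h1 : phi w' c <= phi w c + d / 2 by near: w'; apply: IH.
  have : w' < w + d / 2 / l c.
    by near: w'; apply: nbhs_right_lt; rewrite ltrDl divr_gt0.
  rewrite -(ltr_pM2r (l_gt0 c)) mulrDl divfK ?gt_eqF //.
  by lra.
apply: filterS => w' hw'; rewrite !phi_junction //.
exact: le_trans (le_junction hw') hd.
Unshelve. all: by end_near. Qed.

(** * Half turns at the root *)

Definition turns w : int := wind (end_angle w e0).

(** The root is a leaf, so no Kirchhoff condition costs a dimension there: a nodal [e0] counts
    fully. *)
Definition turns_jump w : nat := (\sum_e excess w e + (sin (end_angle w e0) == 0%R))%N.

(** With [turns_left], this makes [turns_jump w] the exact jump of [turns] at [w]. *)
Lemma turns_strict w' w : w' < w -> turns w' + (turns_jump w)%:Z <= turns w.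
Proof.
move=> ww'; have [D DE] := exists_excess_below w.
rewrite /turns_jump -(excess_below_root DE).
have h : end_angle w' e0 + pi * (D e0)%:R < end_angle w e0.
  have := phi_strict DE e0 ww'; rewrite /end_angle.
  rewrite -(ltr_pM2r (l_gt0 e0)) in ww'; lra.
have /andP[h1 _] := wind_itv (end_angle w' e0).
rewrite /turns; have [/eqP|_] := eqVneq (sin (end_angle w e0)) 0.
  rewrite sin_eq0 => /eqP e; rewrite addn1 -[_.+1%:Z]/(D e0).+1%:Z intS addrCA addrC lezD1.
  rewrite -(ltr_int R) -(ltr_pM2l (pi_gt0 R)) -e intrD mulrDr.
  by apply: le_lt_trans h; rewrite lerD2r.
by rewrite addn0 wind_ge intrD mulrDr (le_trans _ (ltW h)) // lerD2r.
Qed.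

Lemma turns_left w : \forall w' \near w^'-, turns w <= turns w' + (turns_jump w)%:Z.
Proof.
have [D DE] := exists_excess_below w.
rewrite /turns_jump -(excess_below_root DE).
have /andP[h1 h2] := wind_itv (end_angle w e0).
have near_theta eps : 0 < eps ->
    \forall w' \near w^'-, end_angle w e0 - pi * (D e0)%:R - eps <= end_angle w' e0.
  move=> eps0; near=> w'; rewrite /end_angle.
  have p1 : phi w e0 - pi * (D e0)%:R - eps / 2 <= phi w' e0.
    by near: w'; apply: phi_left; rewrite ?divr_gt0.
  have : w - eps / 2 / l e0 < w'.
    by near: w'; apply: nbhs_left_gt; rewrite gtrBl !divr_gt0.
  rewrite ltrBlDr -(ltr_pM2r (l_gt0 e0)) mulrDl divfK ?gt_eqF //.
  by lra.
have pi0 := pi_gt0 R.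
rewrite /turns; have [/eqP|hs] := eqVneq (sin (end_angle w e0)) 0.
  rewrite sin_eq0; set n := wind _ => /eqP e.
  (* At a nodal root angle the jump counts one more half turn, so a tolerance of pi is
     affordable. *)
  have := near_theta _ pi0; apply: filterS => w'; rewrite e => h.
  rewrite addn1 -lerBlDr wind_ge intrB mulrBr; apply: le_trans h.
  by rewrite -[_.+1%:~R]/((D e0).+1%:R) -natr1 mulrDr mulr1; lra.
have : 0 < end_angle w e0 - pi * (wind (end_angle w e0))%:~R.
  by rewrite subr_gt0 lt_neqAle eq_sym -sin_eq0 hs.
move/near_theta; apply: filterS => w' h.
rewrite addn0 -lerBlDr wind_ge intrB mulrBr; apply: le_trans h.
by rewrite -[(D e0)%:Z%:~R]/((D e0)%:R); lra.
Unshelve. all: by end_near. Qed.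

Lemma turns_right w : \forall w' \near w^'+, turns w' <= turns w.
Proof.
have /andP[_ h2] := wind_itv (end_angle w e0).
have [eps eps0 he] : exists2 eps, 0 < eps &
    end_angle w e0 + 2 * eps = pi * (wind (end_angle w e0))%:~R + pi.
  exists ((pi * (wind (end_angle w e0))%:~R + pi - end_angle w e0) / 2); last by field.
  by rewrite divr_gt0 // subr_gt0.
near=> w'.
have p1 : phi w' e0 <= phi w e0 + eps / 2.
  by near: w'; apply: phi_right; rewrite divr_gt0.
have : w' < w + eps / 2 / l e0.
  by near: w'; apply: nbhs_right_lt; rewrite ltrDl divr_gt0 // divr_gt0.
rewrite -(ltr_pM2r (l_gt0 e0)) mulrDl divfK ?gt_eqF // => p2.
rewrite -ltzD1 ltNge /turns wind_ge -ltNge intrD mulrDr mulr1 -he /end_angle.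
by lra.
Unshelve. all: by end_near. Qed.

Lemma turns_double w : 2 * turns w <= turns (2 * w).
Proof.
apply: le_trans (wind_double _) _; apply: le_wind.
by rewrite /end_angle mulrDr mulrA lerD2r phi_double.
Qed.

Lemma turns0 : turns 0 = 0.
Proof. by rewrite /turns /end_angle phi0 mul0r addr0 /wind mul0r floor0. Qed.

Lemma turns_ge0 w : 0 <= w -> 0 <= turns w.
Proof.
move=> w0; rewrite /turns wind_ge mulr0 addr_ge0 ?phi_ge0 //.
by rewrite mulr_ge0 // ltW.
Qed.

(** * The eigenspace as a linear system of amplitudes *)

Section Amplitude.
Variable w : R.
Implicit Types t s : E -> R.

Definition nodal c := sin (end_angle w c) == 0.

(* [t e * sin (phi w e + w * y)], with [y] the distance to the bottom of [e],
   describes an eigenfunction for [w ^+ 2]. *)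
Definition amplitude t :=
  [/\ forall e c, is_child e c -> t c * sin (end_angle w c) = t e * sin (phi w e),
      forall e, (exists c, is_child e c) ->
        \sum_(c | is_child e c) t c * cos (end_angle w c) = t e * cos (phi w e) &
      t e0 * sin (end_angle w e0) = 0].

(* Above a vertex the amplitudes of all nodal edges but one can be chosen
   freely; the last one is then given by the Kirchhoff condition. *)
Definition special e := [pick c | is_child e c && nodal c].

Definition free_edge c := nodal c && [forall e, is_child e c ==> (special e != Some c)].

Lemma child_uniq e e' c : is_child e c -> is_child e' c -> e = e'.
Proof. by move=> /eqP h /eqP h'; apply: bot_inj; rewrite -h -h'. Qed.

Lemma childNroot e : is_child e e0 = false.
Proof.
have /eqP e0r : top e0 == r by rewrite top_root.
by rewrite /is_child e0r eq_sym (negPf (bot_root e)).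
Qed.

Lemma free_child e c : is_child e c -> free_edge c = nodal c && (special e != Some c).
Proof.
move=> ec; rewrite /free_edge; congr (_ && _); apply/forallP/idP => [/(_ e)|h e'].
  by rewrite ec.
by apply/implyP => /(child_uniq ec) <-.
Qed.

Lemma free_root : free_edge e0 = nodal e0.
Proof.
rewrite /free_edge (_ : [forall e, _]) ?andbT //; apply/forallP => e.
by rewrite childNroot.
Qed.

Lemma sum_free_child e : (\sum_(c | is_child e c) free_edge c = excess w e)%N.
Proof.
rewrite /excess /nodal_count.
have -> : (\sum_(c | is_child e c) free_edge c =
    #|[pred c | [&& is_child e c, nodal c & special e != Some c]]|)%N.
  rewrite -sum1_card [RHS]big_mkcond [LHS]big_mkcond; apply: eq_bigr => c _.
  by rewrite inE; case ec : (is_child e c) => //=; rewrite (free_child ec); case: (_ && _).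
rewrite /special; case: pickP => [s /andP[es ns]|nos].
  rewrite (cardD1 s [pred c | is_child e c && (sin (end_angle w c) == 0)]).
  rewrite inE es /= -/(nodal s) ns /=.
  apply: eq_card => c; rewrite !inE /= -/(nodal c) [Some s == _]eq_sym.
  by rewrite andbA andbC.
rewrite !eq_card0 // => c; rewrite !inE.
by rewrite andbA nos.
Qed.

Lemma card_free : #|free_edge| = turns_jump w.
Proof.
rewrite /turns_jump -sum1_card big_mkcond /= -(eq_bigr _ (fun e _ => sum_free_child e)).
transitivity (\sum_e free_edge e)%N.
  by apply: eq_bigr => e _; rewrite -[e \in _]/(free_edge e); case: (free_edge e).
rewrite addnC -[sin _ == 0]/(nodal e0) -free_root.
exact: (sum_child (fun c => nat_of_bool (free_edge c))).
Qed.

(** A square system, one equation per edge: a prescribed value on a free edge, the Kirchhoff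
    condition at the upper vertex for a special edge, continuity there for a non-nodal edge. The
    sums over [is_child e c] have the parent as only term; for [e0] they are empty, which yields the
    Dirichlet condition at the root. *)
Definition amplitude_map t c : R :=
  if free_edge c then t c
  else if nodal c then \sum_(c' | top c' == top c) t c' * cos (end_angle w c')
                       - \sum_(e | is_child e c) t e * cos (phi w e)
  else t c * sin (end_angle w c) - \sum_(e | is_child e c) t e * sin (phi w e).

Lemma sum_parent (f : E -> R) e c : is_child e c -> \sum_(e | is_child e c) f e = f e.
Proof.
move=> ec; rewrite (big_pred1 e) // => e' /=.
by apply/idP/eqP => [/(child_uniq ec)|->].
Qed.

Lemma amplitude_map_linear k s t c :
  amplitude_map (fun e => k * s e + t e) c = k * amplitude_map s c + amplitude_map t c.
Proof.
rewrite /amplitude_map; case: ifP => // _.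
have dist (P : pred E) (g : E -> R) : \sum_(i | P i) (k * s i + t i) * g i =
    k * (\sum_(i | P i) s i * g i) + \sum_(i | P i) t i * g i.
  by rewrite mulr_sumr -big_split; apply: eq_bigr => i _; rewrite mulrDl mulrA.
by case: ifP => _; rewrite !dist; ring.
Qed.

(** The conditions without an equation are automatic: at a nodal child both sides of continuity
    vanish, and at a vertex without nodal children the Kirchhoff condition follows from continuity
    by additivity of cotangents. *)
Lemma amplitude_map_eq0 t : (forall c, ~~ free_edge c -> amplitude_map t c = 0) -> amplitude t.
Proof.
move=> t0.
have S1 e c : is_child e c -> t c * sin (end_angle w c) = t e * sin (phi w e).
  move=> ec; have [/eqP nc|nc] := boolP (nodal c).
    by rewrite phi_junction ?(junction_nodal ec nc) ?nc ?mulr0 //; exists c.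
  have := t0 c; rewrite /amplitude_map {1 2}/free_edge (negPf nc) => /(_ isT)/eqP.
  by rewrite (sum_parent _ ec) subr_eq0 => /eqP.
split => // [e ex|]; last first.
  have [/eqP ->|nc] := boolP (nodal e0); first by rewrite mulr0.
  have := t0 e0; rewrite /amplitude_map free_root (negPf nc) => /(_ isT).
  by rewrite big_pred0 ?subr0 // => e; rewrite childNroot.
case sp : (special e) => [s|]; have := sp; rewrite /special; case: pickP => //.
  move=> x /andP[ec nx] [xs]; have [es ns] : is_child e s /\ nodal s by rewrite -xs.
  have nf : ~~ free_edge s by rewrite (free_child es) ns sp eqxx.
  have := t0 s nf; rewrite /amplitude_map (negPf nf) ns (sum_parent _ es) => /eqP.
  by rewrite subr_eq0 => /eqP <-; move: es => /eqP ->.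
move=> nos _; have nod c : is_child e c -> sin (end_angle w c) != 0.
  by move=> ec; have := nos c; rewrite ec /= => /negbT.
have [sn ct] := junction_cot nod; rewrite -phi_junction // in sn ct.
transitivity (t e * sin (phi w e) * cot (phi w e)); last first.
  by rewrite -mulrA [sin _ * _]mulrC /cot divfK.
rewrite ct mulr_sumr; apply: eq_bigr => c ec; rewrite -(S1 e c ec) -mulrA.
by rewrite [sin _ * _]mulrC /cot divfK // nod.
Qed.

(** From the root downwards: below an edge of amplitude 0, continuity kills the non-nodal children,
    and the Kirchhoff condition kills the special one, whose cosine is nonzero. *)
Lemma amplitude_free0 t : amplitude t -> (forall c, free_edge c -> t c = 0) -> forall e, t e = 0.
Proof.
move=> [S1 S2 S3] t0; elim/top_down_ind => [|p c pc tp].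
  have [n0|n0] := boolP (nodal e0); first by rewrite t0 ?free_root.
  by move/eqP: S3; rewrite mulf_eq0 -/(nodal e0) (negPf n0) orbF => /eqP.
have nonnod c' : is_child p c' -> ~~ nodal c' -> t c' = 0.
  move=> pc' nc'; have /eqP := S1 p c' pc'.
  by rewrite tp mul0r mulf_eq0 -/(nodal c') (negPf nc') orbF => /eqP.
have [nc|] := boolP (nodal c); last exact: nonnod.
have [fc|] := boolP (free_edge c); first exact: t0.
rewrite (free_child pc) nc /= negbK => /eqP sp.
have /eqP := S2 p (ex_intro _ c pc); rewrite tp mul0r (bigD1 c) //=.
rewrite big1 => [|c' /andP[pc' cc']].
  by rewrite addr0 mulf_eq0 (negPf (cos_neq0 (eqP nc))) orbF => /eqP.
have [nc'|/(nonnod _ pc')->] := boolP (nodal c'); last by rewrite mul0r.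
rewrite t0 ?mul0r // (free_child pc') nc' sp /=.
by apply: contra cc' => /eqP[->].
Qed.

(** The square system is injective by [amplitude_free0], hence solvable for any free values. *)
Lemma exists_amplitude (y : E -> R) :
  exists2 t, amplitude t & forall c, free_edge c -> t c = y c.
Proof.
have [|t ty] := linear_inj_surj amplitude_map_linear _
    (fun c => if free_edge c then y c else 0).
  move=> t t0; apply: amplitude_free0 => [|c fc].
    by apply: amplitude_map_eq0 => c _.
  by have := t0 c; rewrite /amplitude_map fc.
exists t => [|c fc]; last by have := ty c; rewrite /amplitude_map fc.
by apply: amplitude_map_eq0 => c /negPf nf; rewrite ty nf.
Qed.

Lemma amplitude_sum (I : finType) (c : I -> R) (t : I -> E -> R) :
  (forall i, c i != 0 -> amplitude (t i)) -> amplitude (fun e => \sum_i c i * t i e).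
Proof.
move=> ampt; split=> [e b eb|e ex|].
- rewrite !mulr_suml; apply: eq_bigr => i _.
  have [->|/ampt[S1 _ _]] := eqVneq (c i) 0; first by rewrite !mul0r.
  by rewrite -!mulrA (S1 e).
- under eq_bigr do rewrite mulr_suml.
  rewrite exchange_big mulr_suml; apply: eq_bigr => i _.
  have [->|/ampt[_ S2 _]] := eqVneq (c i) 0.
    by rewrite !mul0r big1 // => *; rewrite !mul0r.
  by rewrite -mulrA -S2 // mulr_sumr; apply: eq_bigr => b _; rewrite mulrA.
- rewrite mulr_suml big1 // => i _.
  have [->|/ampt[_ _ S3]] := eqVneq (c i) 0; first by rewrite !mul0r.
  by rewrite -mulrA S3 mulr0.
Qed.

End Amplitude.
End Angle.
End RootedTree.

(** * Eigenfunctions on one edge *)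

Section Sinusoid.
Variable R : realType.
Implicit Types t a k x l : R.

Lemma is_derive_affine a k x : is_derive x 1 (fun y => a + k * y) k.
Proof.
rewrite -[X in is_derive _ _ _ X]add0r -[X in _ + X]mulr1.
exact: is_deriveD.
Qed.

Lemma is_derive_sinusoid t a k x :
  is_derive x 1 (fun y => t * sin (a + k * y)) (t * k * cos (a + k * x)).
Proof.
have h := is_derive1_comp (g := fun y => a + k * y)
  (is_derive_sin (a + k * x)) (is_derive_affine a k x).
have := is_deriveZ t h; rewrite /GRing.scale /= => /is_derive_eq; apply.
by rewrite [cos _ * _]mulrC mulrA.
Qed.

Lemma is_derive_cosinusoid t a k x :
  is_derive x 1 (fun y => t * cos (a + k * y)) (- (t * k * sin (a + k * x))).
Proof.
have h := is_derive1_comp (g := fun y => a + k * y)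
  (is_derive_cos (a + k * x)) (is_derive_affine a k x).
have := is_deriveZ t h; rewrite /GRing.scale /= => /is_derive_eq; apply.
by ring.
Qed.

Lemma derive1_sinusoid t a k :
  (fun y => t * sin (a + k * y))^`()%classic = (fun x => t * k * cos (a + k * x)).
Proof.
by apply/funext => x; rewrite derive1E (@derive_val _ _ _ _ _ _ _ (is_derive_sinusoid t a k x)).
Qed.

Lemma derive2_sinusoid t a k x :
  (fun y => t * sin (a + k * y))^`(2)%classic x = - (k ^+ 2 * (t * sin (a + k * x))).
Proof.
rewrite derive1nS derive1n1 derive1_sinusoid derive1E.
by rewrite (@derive_val _ _ _ _ _ _ _ (is_derive_cosinusoid (t * k) a k x)); ring.
Qed.

Lemma is_derive_continuous (f : R -> R) x d : is_derive x 1 f d -> {for x, continuous f}.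
Proof.
by move=> [h _]; apply: differentiable_continuous; apply/derivable1_diffP.
Qed.

Lemma sinusoid_regular t a k l (f := fun y => t * sin (a + k * y)) :
  [/\ derivable_oo_LRcontinuous f 0 l,
      {in `]0, l[, forall x, derivable f^`()%classic x 1},
      f^`()%classic x @[x --> 0^'+] --> t * k * cos a &
      f^`()%classic x @[x --> l^'-] --> t * k * cos (a + k * l)].
Proof.
rewrite /f derive1_sinusoid; split.
- split=> [x _||].
  + by have [] := is_derive_sinusoid t a k x.
  + by apply: cvg_at_right_filter; apply: is_derive_continuous (is_derive_sinusoid t a k 0).
  + by apply: cvg_at_left_filter; apply: is_derive_continuous (is_derive_sinusoid t a k l).
- by move=> x _; have [] := is_derive_cosinusoid (t * k) a k x.
- apply: cvg_at_right_filter.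
  have := is_derive_continuous (is_derive_cosinusoid (t * k) a k 0).
  by rewrite /prop_for /continuous_at mulr0 addr0.
- apply: cvg_at_left_filter.
  exact: is_derive_continuous (is_derive_cosinusoid (t * k) a k l).
Qed.

Lemma derive_ge0_le (f df : R -> R) l :
  (forall x, x \in `]0, l[ -> is_derive x 1 f (df x)) ->
  (forall x, x \in `]0, l[ -> 0 <= df x) ->
  {in `]0, l[ &, {homo f : x y / x <= y}}.
Proof.
move=> fdf df0 x y xl yl; rewrite le_eqVlt => /predU1P[->//|xy].
have sub z : z \in `[x, y] -> z \in `]0, l[.
  move: xl yl; rewrite !in_itv /= => /andP[x0 _] /andP[_ yl] /andP[xz zy].
  by rewrite (lt_le_trans x0 xz) (le_lt_trans zy yl).
have sub' z : z \in `]x, y[ -> z \in `]0, l[.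
  by move=> zxy; apply: sub; apply: subset_itv_oo_cc zxy.
have cf : {within `[x, y], continuous f}.
  apply: continuous_in_subspaceT => z /set_mem /sub /fdf; exact: is_derive_continuous.
have [c cxy e] := MVT xy (fun z zxy => fdf z (sub' z zxy)) cf.
by rewrite -subr_ge0 e mulr_ge0 ?subr_ge0 ?(ltW xy) // df0 // sub'.
Qed.

Lemma derive_eq0_cst (f : R -> R) l :
  (forall x, x \in `]0, l[ -> is_derive x 1 f 0) ->
  {in `]0, l[ &, forall x y, f x = f y}.
Proof.
move=> f0.
have f0N x : x \in `]0, l[ -> is_derive x 1 (- f) 0.
  by move=> /f0 h; rewrite -[0]oppr0; apply: is_deriveN.
have H := derive_ge0_le f0 (fun _ _ => lexx 0).
have HN := derive_ge0_le f0N (fun _ _ => lexx 0).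
move=> x y xl yl; wlog xy : x y xl yl / x <= y => [W|].
  by have [/W->//|/ltW/W->] := leP x y.
apply/le_anti; rewrite H //=.
by have := HN x y xl yl xy; rewrite /GRing.opp /= lerN2.
Qed.

Lemma itvoo0_nonempty l : 0 < l -> l / 2 \in `]0, l[.
Proof. by move=> l0; rewrite in_itv /= divr_gt0 //=; lra. Qed.

Lemma near0_itv l : 0 < l -> \forall x \near 0^'+, x \in `]0, l[.
Proof.
by move=> l0; near=> x; rewrite in_itv /=; apply/andP; split => //;
  near: x; apply: nbhs_right_lt.
Unshelve. all: by end_near. Qed.

Lemma nearl_itv l : 0 < l -> \forall x \near l^'-, x \in `]0, l[.
Proof.
by move=> l0; near=> x; rewrite in_itv /=; apply/andP; split => //;
  near: x; apply: nbhs_left_gt.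
Unshelve. all: by end_near. Qed.

Lemma eq_oo_cvg_right (f g : R -> R) l : 0 < l -> {in `]0, l[, f =1 g} ->
  {for 0, continuous g} -> f x @[x --> 0^'+] --> g 0.
Proof.
move=> l0 fg cg; apply: cvg_trans (cvg_at_right_filter cg).
by apply: near_eq_cvg; apply: filterS (near0_itv l0) => x /fg.
Qed.

Lemma eq_oo_cvg_left (f g : R -> R) l : 0 < l -> {in `]0, l[, f =1 g} ->
  {for l, continuous g} -> f x @[x --> l^'-] --> g l.
Proof.
move=> l0 fg cg; apply: cvg_trans (cvg_at_left_filter cg).
by apply: near_eq_cvg; apply: filterS (nearl_itv l0) => x /fg.
Qed.

(* The quantities [w f cos - f' sin] and [w f sin + f' cos] are constant. *)
Lemma harmonic_eq (f : R -> R) w l : 0 < l -> w != 0 ->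
  derivable_oo_LRcontinuous f 0 l ->
  {in `]0, l[, forall x, derivable f^`()%classic x 1} ->
  {in `]0, l[, forall x, - f^`(2)%classic x = w ^+ 2 * f x} ->
  exists A B, [/\ {in `[0, l], forall x, f x = A * cos (w * x) + B * sin (w * x)},
    f^`()%classic x @[x --> 0^'+] --> w * B &
    f^`()%classic x @[x --> l^'-] --> w * (B * cos (w * l) - A * sin (w * l))].
Proof.
move=> l0 w0 [df fr fl] ddf eqf.
have isf x : x \in `]0, l[ -> is_derive x 1 f (f^`()%classic x).
  by move=> /df h; rewrite derive1E; apply: derivableP.
have isdf x : x \in `]0, l[ -> is_derive x 1 f^`()%classic (- (w ^+ 2 * f x)).
  move=> xl; have := derivableP (ddf x xl); rewrite -derive1E -derive1n1 -derive1nS.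
  by rewrite -(eqf x xl) opprK.
have issin x : is_derive x 1 (fun y => sin (w * y)) (w * cos (w * x)).
  have := is_derive_sinusoid 1 0 w x; rewrite add0r mul1r.
  by congr is_derive; apply/funext => y; rewrite add0r mul1r.
have iscos x : is_derive x 1 (fun y => cos (w * y)) (- (w * sin (w * x))).
  have := is_derive_cosinusoid 1 0 w x; rewrite add0r mul1r.
  by congr is_derive; apply/funext => y; rewrite add0r mul1r.
pose P x := w * f x * cos (w * x) - f^`()%classic x * sin (w * x).
pose Q x := w * f x * sin (w * x) + f^`()%classic x * cos (w * x).
have P0 x : x \in `]0, l[ -> is_derive x 1 P 0.
  move=> xl; have iswf := is_deriveZ w (isf x xl).
  have := is_deriveB (is_deriveM iswf (iscos x)) (is_deriveM (isdf x xl) (issin x)).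
  move=> /is_derive_eq; apply; rewrite /GRing.scale /= -[w *: f x]/(w * f x); ring.
have Q0 x : x \in `]0, l[ -> is_derive x 1 Q 0.
  move=> xl; have iswf := is_deriveZ w (isf x xl).
  have := is_deriveD (is_deriveM iswf (issin x)) (is_deriveM (isdf x xl) (iscos x)).
  move=> /is_derive_eq; apply; rewrite /GRing.scale /= -[w *: f x]/(w * f x); ring.
have hl := itvoo0_nonempty l0.
have [A PA] : exists A, forall x, x \in `]0, l[ -> P x = w * A.
  by exists (P (l / 2) / w) => x xl; rewrite mulrC divfK //; apply: (derive_eq0_cst P0).
have [B QB] : exists B, forall x, x \in `]0, l[ -> Q x = w * B.
  by exists (Q (l / 2) / w) => x xl; rewrite mulrC divfK //; apply: (derive_eq0_cst Q0).
pose g x := A * cos (w * x) + B * sin (w * x).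
pose dg x := w * (B * cos (w * x) - A * sin (w * x)).
have fg : {in `]0, l[, f =1 g}.
  move=> x xl; apply: (mulfI w0); rewrite /g mulrDr !mulrA -(PA x xl) -(QB x xl).
  rewrite /P /Q -[LHS]mulr1 -(cos2Dsin2 (w * x)); ring.
have dfg : {in `]0, l[, f^`()%classic =1 dg}.
  move=> x xl; rewrite /dg mulrBr !mulrA -(PA x xl) -(QB x xl).
  rewrite /P /Q -[LHS]mulr1 -(cos2Dsin2 (w * x)); ring.
have csin x : {for x, continuous (fun y => sin (w * y))} by apply: is_derive_continuous (issin x).
have ccos x : {for x, continuous (fun y => cos (w * y))} by apply: is_derive_continuous (iscos x).
have cg x : {for x, continuous g} by apply: cvgD; apply: cvgMr; [exact: ccos|exact: csin].
have cdg x : {for x, continuous dg}.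
  by apply: cvgMr; apply: cvgB; apply: cvgMr; [exact: ccos|exact: csin].
have f_0 : f 0 = g 0.
  exact: (cvg_unique _ fr (eq_oo_cvg_right l0 fg (cg 0))).
have f_l : f l = g l.
  exact: (cvg_unique _ fl (eq_oo_cvg_left l0 fg (cg l))).
exists A, B; split.
- move=> x; rewrite in_itv /= !le_eqVlt => /andP[/predU1P[<-//|x0] /predU1P[->//|xl]].
  by apply: fg; rewrite in_itv /= x0.
- have := eq_oo_cvg_right l0 dfg (cdg 0).
  by rewrite /dg mulr0 cos0 sin0 mulr1 mulr0 subr0.
- exact: eq_oo_cvg_left l0 dfg (cdg l).
Qed.

End Sinusoid.

(** * Linear relations and nonpositive eigenvalues on one edge *)

Section EdgeFunctions.
Variable R : realType.

Lemma is_derive_eq0 (f df : R -> R) (l : R) : 0 < l ->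
  (forall x : R, is_derive x 1 f (df x)) -> continuous df ->
  {in `[0, l], forall x, f x = 0} -> {in `[0, l], forall x, df x = 0}.
Proof.
move=> l0 fdf cdf f0.
have df0 : {in `]0, l[, (fun=> 0) =1 df}.
  move=> x xl; have h : \near x, cst (0 : R) x = f x.
    apply: filterS (near_in_itvoo xl) => y /subset_itv_oo_cc yl.
    by rewrite f0.
  have hc : is_derive x 1 ((fun=> 0) : R -> R) 0 by exact: is_derive_cst.
  have /@derive_val <- := near_eq_is_derive h hc.
  by have /@derive_val -> := fdf x.
have df_0 : df 0 = 0 by rewrite -(norm_cvg_lim (eq_oo_cvg_right l0 df0 (cdf 0))) lim_cst.
have df_l : df l = 0 by rewrite -(norm_cvg_lim (eq_oo_cvg_left l0 df0 (cdf l))) lim_cst.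
move=> x; rewrite in_itv /= !le_eqVlt => /andP[/predU1P[<-//|x0] /predU1P[->//|xl]].
by rewrite -df0 // in_itv /= x0.
Qed.

(** Two derivatives multiply each sinusoid by minus its squared frequency. This will separate
    eigenfunctions of different eigenvalues. *)
Lemma sum_sinusoid_eq0 (n : nat) (t a k : 'I_n -> R) (l : R) : 0 < l ->
  {in `[0, l], forall x, \sum_i t i * sin (a i + k i * x) = 0} ->
  {in `[0, l], forall x, \sum_i k i ^+ 2 * (t i * sin (a i + k i * x)) = 0}.
Proof.
move=> l0 f0.
have d1 (x : R) : is_derive x 1 (fun x => \sum_i t i * sin (a i + k i * x))
    (\sum_i t i * k i * cos (a i + k i * x)).
  have := is_derive_sum (fun i => is_derive_sinusoid (t i) (a i) (k i) x).
  by rewrite fct_sumE.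
have d2 (x : R) : is_derive x 1 (fun x => \sum_i t i * k i * cos (a i + k i * x))
    (\sum_i - (t i * k i * k i * sin (a i + k i * x))).
  have := is_derive_sum (fun i => is_derive_cosinusoid (t i * k i) (a i) (k i) x).
  by rewrite fct_sumE.
(* Gives continuity of the second derivative, which carries its vanishing to the ends of the
   interval. *)
have d3 (x : R) : is_derive x 1 (fun x => \sum_i - (t i * k i * k i * sin (a i + k i * x)))
    (\sum_i (- (t i * k i * k i)) * k i * cos (a i + k i * x)).
  have := is_derive_sum (fun i => is_derive_sinusoid (- (t i * k i * k i)) (a i) (k i) x).
  by rewrite fct_sumE; congr is_derive; apply/funext => y; apply: eq_bigr => i _; rewrite mulNr.
have e1 := is_derive_eq0 l0 d1 (fun x => is_derive_continuous (d2 x)) f0.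
have e2 := is_derive_eq0 l0 d2 (fun x => is_derive_continuous (d3 x)) e1.
move=> x xl; apply: oppr_inj; rewrite oppr0 -[RHS](e2 x xl) -sumrN.
by apply: eq_bigr => i _; ring.
Qed.

(* [f f'] is nondecreasing as its derivative is [f'^2 - nu f^2]. *)
Lemma nonpos_edge (f : R -> R) nu l (d0 dl : R) : 0 < l -> nu <= 0 ->
  derivable_oo_LRcontinuous f 0 l ->
  {in `]0, l[, forall x, derivable f^`()%classic x 1} ->
  f^`()%classic x @[x --> 0^'+] --> d0 -> f^`()%classic x @[x --> l^'-] --> dl ->
  {in `]0, l[, forall x, - f^`(2)%classic x = nu * f x} ->
  f 0 * d0 <= f l * dl /\
  (f 0 * d0 = f l * dl -> {in `[0, l], forall x, f x = f 0}).
Proof.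
move=> l0 nu0 [df fr fl] ddf dr dl' feq.
have isf x : x \in `]0, l[ -> is_derive x 1 f (f^`()%classic x).
  by move=> /df h; rewrite derive1E; apply: derivableP.
have isdf x : x \in `]0, l[ -> is_derive x 1 f^`()%classic (- (nu * f x)).
  move=> xl; have := derivableP (ddf x xl); rewrite -derive1E -derive1n1 -derive1nS.
  by rewrite -(feq x xl) opprK.
pose g x := f x * f^`()%classic x.
pose dg x := f^`()%classic x ^+ 2 - nu * f x ^+ 2.
have isg x : x \in `]0, l[ -> is_derive x 1 g (dg x).
  move=> xl; have := is_deriveM (isf x xl) (isdf x xl).
  by move=> /is_derive_eq; apply; rewrite /dg /GRing.scale /=; ring.
have dg0 x : x \in `]0, l[ -> 0 <= dg x.
  by move=> _; rewrite addr_ge0 ?sqr_ge0 // -mulNr mulr_ge0 ?oppr_ge0 // sqr_ge0.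
have g_le := derive_ge0_le isg dg0.
have gr : g x @[x --> 0^'+] --> f 0 * d0 by apply: cvgM.
have gl : g x @[x --> l^'-] --> f l * dl by apply: cvgM.
have ge0 x : x \in `]0, l[ -> f 0 * d0 <= g x.
  move=> xl; have xl' := xl; move: xl'; rewrite in_itv /= => /andP[x0 _].
  rewrite -(norm_cvg_lim gr); apply: limr_le; first by apply/cvg_ex; exists (f 0 * d0).
  near=> y; apply: g_le => //; last by apply/ltW; near: y; apply: nbhs_right_lt.
  by near: y; apply: near0_itv.
have gel x : x \in `]0, l[ -> g x <= f l * dl.
  move=> xl; have xl' := xl; move: xl'; rewrite in_itv /= => /andP[_ x1].
  rewrite -(norm_cvg_lim gl); apply: limr_ge; first by apply/cvg_ex; exists (f l * dl).
  near=> y; apply: g_le => //; last by apply/ltW; near: y; apply: nbhs_left_gt.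
  by near: y; apply: nearl_itv.
have hl := itvoo0_nonempty l0.
split=> [|e]; first exact: le_trans (ge0 _ hl) (gel _ hl).
(* Equality makes f f' constant, so both nonnegative terms of its derivative vanish, in particular
   f'^2. *)
have f'0 x : x \in `]0, l[ -> is_derive x 1 f 0.
  move=> xl; suff <- : f^`()%classic x = 0 by exact: isf.
  have h : \near x, cst (f 0 * d0) x = g x.
    apply: filterS (near_in_itvoo xl) => y yl.
    by apply/le_anti; rewrite ge0 //= e gel.
  have : dg x = 0.
    have /@derive_val <- := isg x xl.
    have hc : is_derive x 1 ((fun=> f 0 * d0) : R -> R) 0 by exact: is_derive_cst.
    by have /@derive_val := near_eq_is_derive h hc.
  move/eqP; rewrite /dg paddr_eq0 ?sqr_ge0 //.
    by rewrite sqrf_eq0 => /andP[/eqP].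
  by rewrite -mulNr mulr_ge0 ?oppr_ge0 // sqr_ge0.
pose c := f (l / 2).
have fc : {in `]0, l[, f =1 cst c} by move=> x xl; apply: (derive_eq0_cst f'0).
have f0c : f 0 = c.
  by rewrite -(norm_cvg_lim fr) (norm_cvg_lim (eq_oo_cvg_right l0 fc (@cst_continuous _ _ c 0))).
have flc : f l = c.
  by rewrite -(norm_cvg_lim fl) (norm_cvg_lim (eq_oo_cvg_left l0 fc (@cst_continuous _ _ c l))).
move=> x; rewrite in_itv /= !le_eqVlt f0c => /andP[/predU1P[<-//|x0] /predU1P[->//|xl]].
by apply: fc; rewrite in_itv /= x0.
Unshelve. all: by end_near. Qed.

End EdgeFunctions.

(** * Rooting a metric tree at a leaf *)

Section Rooting.
Variables (R : realType) (G : metric_graph R).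
Hypothesis hG : is_tree G.
Implicit Types (v r : vertex G) (e : edge G).

(** [depth v] is the length of a shortest walk to [r], and the first edge of such a walk leads
    closer to [r]. *)
Lemma exists_distance r : exists depth : vertex G -> nat, depth r = 0%N /\
  forall v, v != r -> exists p : edge G * bool, endpoint p.1 p.2 = v /\
    (depth (endpoint p.1 (~~ p.2)) < depth v)%N.
Proof.
pose walk v n := `[< exists p : seq (vertex G),
  [/\ path (Defs.adjacent (@endpoint _ G)) v p, last v p = r & size p = n] >].
have walkP v : exists n, walk v n.
  have /connectP[p pv pr] := connected_graph v r.
  by exists (size p); apply/asboolP; exists p.
exists (fun v => ex_minn (walkP v)); split.
  case: ex_minnP => n _ /(_ 0%N); rewrite leqn0 => h; apply/eqP/h.
  by apply/asboolP; exists [::].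
move=> v vr; case: (ex_minnP (walkP v)) => n /asboolP[[|u p] [/= pp pl pn] _].
  by rewrite pl eqxx in vr.
move: pp => /andP[/existsP[e /existsP[b /andP[/eqP eb /eqP eu]]] pu].
exists (e, b); split => //=; rewrite eu -pn ltnS.
by case: ex_minnP => m _; apply; apply/asboolP; exists p.
Qed.

(* Mapping each vertex other than the root to the first edge of a shortest walk
   to the root is injective, hence bijective since |E| = |V| - 1. *)
Lemma exists_rooting r : exists (o : edge G -> bool) (depth : vertex G -> nat),
  [/\ forall e, (depth (endpoint e (~~ o e)) < depth (endpoint e (o e)))%N,
      injective (fun e => endpoint e (o e)),
      forall v, v != r -> exists e, endpoint e (o e) = v,
      forall e, endpoint e (o e) != r & depth r = 0%N].
Proof.
have [depth [depth_r par]] := exists_distance r.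
have /choice[up upP] : forall v : {v | v != r}, exists p : edge G * bool,
    endpoint p.1 p.2 = val v /\ (depth (endpoint p.1 (~~ p.2)) < depth (val v))%N.
  by move=> v; apply: par (valP v).
(* If two vertices chose the same edge from opposite ends, each would be strictly closer to the root
   than the other. *)
have up_inj : injective (fun x => (up x).1).
  move=> x y; have [eu du] := upP x; have [ev dv] := upP y.
  case: (up x) (up y) eu du ev dv => [e b] [e' b'] /= eu du ev dv ee.
  subst e'; apply: val_inj; apply: (etrans (esym eu)); apply: (etrans _ ev); congr endpoint.
  case: b b' eu du ev dv => [] [] // eu du ev dv.
    by move: du dv; rewrite -eu -ev /= => /ltn_trans h /h; rewrite ltnn.
    by move: du dv; rewrite -eu -ev /= => /ltn_trans h /h; rewrite ltnn.
have card_up : (#|edge G| <= #|{: {v | v != r}}|)%N.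
  rewrite card_sig; have := cardC1 r; move: hG; rewrite /is_tree.
  have -> : #|[pred v | v != r]| = #|predC1 r| by apply: eq_card.
  move=> + ->; have := max_card (pred1 r); rewrite card1; lia.
have [g gK Kg] := inj_card_bij up_inj card_up.
have og e : endpoint e (up (g e)).2 = val (g e).
  by have [<- _] := upP (g e); rewrite Kg.
exists (fun e => (up (g e)).2), depth; split => //.
- by move=> e; rewrite og; have [_] := upP (g e); rewrite [(up _).1]Kg.
- by move=> e e'; rewrite !og => /val_inj /(can_inj Kg).
- by move=> v vr; exists (up (Sub v vr)).1; rewrite og gK.
- by move=> e; rewrite og (valP (g e)).
Qed.

(** A vertex of maximal depth is the upper end of no edge, so only the edge above it ends there. *)
Lemma exists_leaf (e1 : edge G) : exists r, is_leaf r.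
Proof.
have [ori [depth [depth_lt o_inj o_surj o_root depth_r]]] := exists_rooting (endpoint e1 false).
have [v _ v_arg] := arg_maxnP depth (isT : xpredT (endpoint e1 false)).
have v_max u : (depth u <= depth v)%N by exact: v_arg.
have vr : v != endpoint e1 false.
  apply: contraTneq (depth_lt e1) => vr; rewrite -leqNgt.
  by apply: leq_trans (v_max _) _; rewrite vr depth_r.
have [e ev] := o_surj v vr; exists v; rewrite /is_leaf /degree -(cards1 (e, ori e)).
apply: eq_card => -[e' b]; rewrite !inE /=; apply/eqP/eqP => [|[-> ->]//] e'v.
have [eb|eb] := eqVneq b (ori e').
  by move: e'v; rewrite eb -ev => /o_inj ->.
have := depth_lt e'; have -> : ~~ ori e' = b by case: b (ori e') eb {e'v} => [] [].
by rewrite e'v ltnNge v_max.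
Qed.

Lemma exists_leaf_rooting (e1 : edge G) :
  exists r (o : edge G -> bool) (depth : vertex G -> nat) e0,
  [/\ is_leaf r,
      forall e, (depth (endpoint e (~~ o e)) < depth (endpoint e (o e)))%N /\
        endpoint e (o e) != r,
      injective (fun e => endpoint e (o e)),
      forall v, v != r -> exists e, endpoint e (o e) = v &
      forall e, (endpoint e (~~ o e) == r) = (e == e0)].
Proof.
have [r leaf_r] := exists_leaf e1.
have [ori [depth [depth_lt o_inj o_surj o_root _]]] := exists_rooting r.
have /eqP := leaf_r; rewrite /degree => /cards1P[[e0 b0] rE].
have re e b : (endpoint e b == r) = (e == e0) && (b == b0).
  by have /setP/(_ (e, b)) := rE; rewrite !inE.
have b0E : b0 = ~~ ori e0.
  by have := o_root e0; rewrite re eqxx; case: (b0) (ori e0) => [] [].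
exists r, ori, depth, e0; split => // e; rewrite re.
by have [->|] //= := eqVneq e e0; rewrite b0E eqxx.
Qed.

End Rooting.

(** * Eigenvalues of a metric tree *)

Section MetricTree.
Variables (R : realType) (G : metric_graph R) (ori : edge G -> bool).
Variables (r : vertex G) (depth : vertex G -> nat) (e0 : edge G).
Implicit Types (e c : edge G) (v : vertex G) (w : R) (t : edge G -> R).

Definition lower e := endpoint e (ori e).
Definition upper e := endpoint e (~~ ori e).
Local Notation child := (is_child lower upper).
Local Notation len := (@len R G).

Hypothesis leaf_r : is_leaf r.
Hypothesis depth_upper : forall e, (depth (upper e) < depth (lower e))%N.
Hypothesis lower_inj : injective lower.
Hypothesis lower_surj : forall v, v != r -> exists e, lower e = v.
Hypothesis lower_root : forall e, lower e != r.
Hypothesis upper_root : forall e, (upper e == r) = (e == e0).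

Variable phi : R -> edge G -> R.
Hypothesis phiE : forall w e, phi w e =
  if [exists c, child e c] then junction (child e) (fun c => phi w c + w * len c)
  else 0.
Local Notation theta := (end_angle len phi).
Local Notation amplitude := (amplitude lower upper e0 len phi).

Lemma sum_ends (M : nmodType) (F : edge G -> bool -> M) v :
  \sum_(p : edge G * bool | endpoint p.1 p.2 == v) F p.1 p.2 =
  \sum_(e | lower e == v) F e (ori e) + \sum_(e | upper e == v) F e (~~ ori e).
Proof.
rewrite -(pair_big_dep xpredT (fun e b => endpoint e b == v) F) /=.
rewrite [X in _ = X + _]big_mkcond [X in _ = _ + X]big_mkcond -big_split.
apply: eq_bigr => e _; rewrite big_mkcond big_bool /lower /upper /=.
by case: (ori e) => //=; rewrite addrC.
Qed.

Lemma sum_lower (M : nmodType) (F : edge G -> M) e :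
  \sum_(e' | lower e' == lower e) F e' = F e.
Proof. by rewrite (big_pred1 e) // => e'; rewrite /= (inj_eq lower_inj). Qed.

(** The lower vertex of [e] carries one end of [e] and the upper ends of its children, so its degree
    is one more than their number. *)
Lemma leaf_lowerP e : is_leaf (lower e) <-> ~ exists c, child e c.
Proof.
have -> : is_leaf (lower e) <-> #|child e| = 0%N.
  rewrite /is_leaf /degree -sum1_card.
  rewrite (eq_bigl (fun p => endpoint p.1 p.2 == lower e)) => [|p]; last by rewrite inE.
  rewrite (sum_ends (fun _ _ => 1%N)) (sum_lower (fun=> 1%N)) sum1_card.
  split=> [[]//|]; rewrite -[#|child e|]/(#|[pred c | upper c == lower e]|) => h.
  by apply/eqP; rewrite -[_ + _]/(1 + _)%N h.
split=> [/card0_eq h [c ec]|h]; first by have := h c; rewrite -[c \in _]/(child e c) ec.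
by apply: eq_card0 => c; apply/negP => ec; apply: h; exists c.
Qed.

(** * Eigenfunctions and amplitudes *)

Definition height_on e x := if ori e then len e - x else x.

Lemma height_on_lower e : height_on e (end_pos e (ori e)) = 0.
Proof. by rewrite /height_on /end_pos; case: (ori e); rewrite ?subrr. Qed.

Lemma height_on_upper e : height_on e (end_pos e (~~ ori e)) = len e.
Proof. by rewrite /height_on /end_pos; case: (ori e); rewrite ?subr0. Qed.

Definition wave w t : graph_fun G :=
  fun e x => t e * sin (phi w e + w * height_on e x).

Lemma wave_sinusoid w t e : wave w t e =
  fun x => t e * sin ((if ori e then theta w e else phi w e) + (if ori e then - w else w) * x).
Proof.
apply/funext => x; rewrite /wave /height_on /end_angle; case: (ori e) => //.
by congr (_ * sin _); ring.
Qed.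

Lemma wave_deriv_lower w t e : deriv_into (wave w t) e (ori e) = - (w * (t e * cos (phi w e))).
Proof.
rewrite /deriv_into wave_sinusoid; case oe : (ori e).
  have [_ _ _ h] := sinusoid_regular (t e) (theta w e) (- w) (len e).
  by rewrite (norm_cvg_lim h) /end_angle mulNr addrK; ring.
have [_ _ h _] := sinusoid_regular (t e) (phi w e) w (len e).
by rewrite (norm_cvg_lim h); ring.
Qed.

Lemma wave_deriv_upper w t e : deriv_into (wave w t) e (~~ ori e) = w * (t e * cos (theta w e)).
Proof.
rewrite /deriv_into wave_sinusoid; case oe : (ori e) => /=.
  have [_ _ h _] := sinusoid_regular (t e) (theta w e) (- w) (len e).
  by rewrite (norm_cvg_lim h); ring.
have [_ _ _ h] := sinusoid_regular (t e) (phi w e) w (len e).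
by rewrite (norm_cvg_lim h) /end_angle; ring.
Qed.

Lemma wave_regular w t e : edge_regular (wave w t) e.
Proof.
rewrite /edge_regular wave_sinusoid; set a := if _ then _ else _; set k := if _ then _ else _.
have [h1 h2 h3 h4] := sinusoid_regular (t e) a k (len e).
by split => //; apply/cvg_ex; eexists; [exact: h3|exact: h4].
Qed.

Lemma wave_eigenspace w t : amplitude w t -> dirichlet_eigenspace (w ^+ 2) (wave w t).
Proof.
move=> [S1 S2 S3]; split => [e||e x _]; first exact: wave_regular; last first.
  rewrite wave_sinusoid derive2_sinusoid opprK.
  by case: (ori e); rewrite ?sqrrN.
(* The value at the vertex [v]; at the root the sum is empty and gives the Dirichlet value 0. *)
pose u v := \sum_(e | lower e == v) t e * sin (phi w e).
have uE e b : wave w t e (end_pos e b) = u (endpoint e b).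
  have [->|] := eqVneq b (ori e).
    by rewrite /wave height_on_lower mulr0 addr0 /u (sum_lower (fun e => t e * sin (phi w e))).
  move=> be; have -> : b = ~~ ori e by case: b (ori e) be => [] [].
  rewrite /wave height_on_upper -/(theta w e).
  have [/eqP|] := eqVneq (upper e) r.
    rewrite upper_root => /eqP ->; rewrite S3 /u big_pred0 // => e'.
    have /eqP : upper e0 == r by rewrite upper_root.
    by rewrite /upper => ->; apply/negbTE.
  move=> /lower_surj[p pe]; rewrite (S1 p) /is_child ?pe // /u.
  by rewrite -[endpoint _ _]pe (sum_lower (fun e => t e * sin (phi w e))).
split.
- by move=> e e' b b' ee'; rewrite !uE ee'.
- move=> e b; rewrite uE; have [->|] := eqVneq (endpoint e b) r.
    by rewrite /u big_pred0 // => e' ; apply/negbTE.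
  move=> /lower_surj[p <-] /leaf_lowerP lp.
  rewrite /u (sum_lower (fun e => t e * sin (phi w e))).
  by rewrite (phi_leaf phiE w lp) sin0 mulr0.
- move=> v nl; have /lower_surj[p pv] : v != r by apply/eqP => vr; apply: nl; rewrite vr.
  have ex : exists c, child p c.
    by apply: contrapT => /leaf_lowerP; rewrite pv.
  rewrite sum_ends -pv (sum_lower (fun e => deriv_into (wave w t) e (ori e))).
  rewrite wave_deriv_lower -(S2 p ex) mulr_sumr.
  under [X in _ + X]eq_bigr do rewrite wave_deriv_upper.
  by rewrite addNr.
Qed.

Lemma eigenfunction_edge w (f : graph_fun G) e : w != 0 -> edge_regular f e ->
  {in `]0, len e[, forall x, - (f e)^`(2)%classic x = w ^+ 2 * f e x} ->
  exists AB : R * R, [/\ {in `[0, len e], forall x, f e x =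
       AB.1 * cos (w * height_on e x) + AB.2 * sin (w * height_on e x)},
    deriv_into f e (ori e) = - (w * AB.2) &
    deriv_into f e (~~ ori e) = w * (AB.2 * cos (w * len e) - AB.1 * sin (w * len e))].
Proof.
move=> w0 [f1 f2 _ _] feq.
have [A [B [h1 h2 h3]]] := harmonic_eq (len_gt0 e) w0 f1 f2 feq.
rewrite /deriv_into /height_on; case: (ori e) => /=; last first.
  by exists (A, B); rewrite (norm_cvg_lim h2) (norm_cvg_lim h3).
exists (A * cos (w * len e) + B * sin (w * len e), A * sin (w * len e) - B * cos (w * len e)).
rewrite (norm_cvg_lim h2) (norm_cvg_lim h3) /=; split => [x xl||]; last 2 first.
- by ring.
- rewrite -[LHS]mulr1 -(cos2Dsin2 (w * len e)); ring.
rewrite h1 // mulrBr cosB sinB.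
rewrite -[LHS]mulr1 -(cos2Dsin2 (w * len e)); ring.
Qed.

Lemma end_pos_itv e b : end_pos e b \in `[0, len e].
Proof.
by rewrite in_itv /end_pos /=; case: b; rewrite lexx ?andbT /= ltW // len_gt0.
Qed.

Lemma eigenspace_wave w (f : graph_fun G) : 0 < w -> dirichlet_eigenspace (w ^+ 2) f ->
  exists2 t, amplitude w t &
    forall e, {in `[0, len e], forall x, f e x = wave w t e x}.
Proof.
move=> w_gt0 [freg [fcont fleaf fkir] feq]; have w0 := lt0r_neq0 w_gt0.
have /choice[AB ABP] : forall e, exists AB : R * R, [/\ {in `[0, len e], forall x, f e x =
       AB.1 * cos (w * height_on e x) + AB.2 * sin (w * height_on e x)},
    deriv_into f e (ori e) = - (w * AB.2) &
    deriv_into f e (~~ ori e) = w * (AB.2 * cos (w * len e) - AB.1 * sin (w * len e))].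
  by move=> e; apply: eigenfunction_edge.
have f_lower e : f e (end_pos e (ori e)) = (AB e).1.
  have [h _ _] := ABP e; rewrite h ?end_pos_itv // height_on_lower.
  by rewrite mulr0 cos0 sin0 mulr0 addr0 mulr1.
have kir e : (exists c, child e c) -> w * (AB e).2 =
    \sum_(c | child e c) deriv_into f c (~~ ori c).
  move=> ex; have := fkir (lower e); rewrite sum_ends.
  rewrite (sum_lower (fun e => deriv_into f e (ori e))).
  have [_ -> _] := ABP e => h; apply/eqP; rewrite eq_sym -subr_eq0 addrC; apply/eqP/h.
  by move=> /leaf_lowerP.
have cont e c : child e c -> f c (end_pos c (~~ ori c)) = (AB e).1.
  by move=> /eqP ec; rewrite -f_lower; apply: fcont.
have f_upper c (t : R) : (AB c).1 = t * sin (phi w c) -> (AB c).2 = t * cos (phi w c) ->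
    f c (end_pos c (~~ ori c)) = t * sin (theta w c) /\
    deriv_into f c (~~ ori c) = w * (t * cos (theta w c)).
  move=> A B; have [h _ ->] := ABP c; rewrite h ?end_pos_itv // height_on_upper.
  by rewrite A B /end_angle sinD cosD; split; ring.
(* [AB e] consists of the value and the derivative divided by [w] at the lower end of [e]. The
   vertex conditions force this vector, from the leaves upwards, onto the line of direction
   [phi w e]. *)
have /choice[t tP] : forall e, exists t : R, (AB e).1 = t * sin (phi w e) /\
    (AB e).2 = t * cos (phi w e).
  elim/(bottom_up_ind depth_upper) => e IH.
  have [ex|nex] := pselect (exists c, child e c); last first.
    exists (AB e).2; rewrite (phi_leaf phiE w nex) sin0 cos0 mulr0 mulr1; split => //.
    by rewrite -f_lower; apply: fleaf; apply/leaf_lowerP.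
  have kids c : child e c -> exists t : R, (AB e).1 = t * sin (theta w c) /\
      deriv_into f c (~~ ori c) = w * (t * cos (theta w c)).
    move=> ec; have [t [tA tB]] := IH c ec; exists t.
    by have [<- <-] := f_upper c t tA tB; rewrite (cont e).
  (* A nodal child forces the value 0 at the vertex; otherwise value and flux are related by the sum
     of the cotangents. *)
  have [[c [ec sc]]|nod] := pselect (exists c, child e c /\ sin (theta w c) = 0).
    have s0 : sin (phi w e) = 0.
      by rewrite (phi_junction phiE w ex) (junction_nodal ec sc).
    have c0 := cos_neq0 s0; exists ((AB e).2 / cos (phi w e)).
    rewrite s0 mulr0 divfK //; split => //.
    by have [t [-> _]] := kids c ec; rewrite sc mulr0.
  have {}nod c : child e c -> sin (theta w c) != 0.
    by move=> ec; apply/eqP => sc; apply: nod; exists c.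
  have [sn ct] := junction_cot nod; rewrite -(phi_junction phiE w ex) in sn ct.
  exists ((AB e).1 / sin (phi w e)); rewrite divfK //; split => //.
  apply: (mulfI w0); rewrite kir // mulrAC -mulrA -/(cot _) ct !mulr_sumr.
  apply: eq_bigr => c ec; have [t [-> ->]] := kids c ec.
  by rewrite /cot -[t * _ * _]mulrA [sin _ * _]mulrC divfK // nod.
have up c := f_upper c (t c) (tP c).1 (tP c).2.
exists t.
  split=> [e c ec|e ex|].
  - by rewrite -(up c).1 (cont e) // (tP e).1.
  - apply: (mulfI w0); rewrite -(tP e).2 kir // mulr_sumr.
    by apply: eq_bigr => c _; rewrite (up c).2.
  - have /eqP e0r : upper e0 == r by rewrite upper_root.
    by rewrite -(up e0).1; apply: fleaf; rewrite -/(upper e0) e0r.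
move=> e x xl; have [-> // _ _] := ABP e.
by rewrite (tP e).1 (tP e).2 /wave sinD; ring.
Qed.

Lemma wave_eq0 w t : 0 < w ->
  (forall e x, x \in `[0, len e] -> wave w t e x = 0) -> forall e, t e = 0.
Proof.
move=> w0 t0 e; have l0 := len_gt0 e.
have sub y : 0 <= y <= len e -> t e * sin (phi w e + w * y) = 0.
  move=> /andP[y0 yl]; pose x := if ori e then len e - y else y.
  have -> : y = height_on e x by rewrite /height_on /x; case: (ori e); rewrite ?subKr.
  apply: (t0 e x); rewrite in_itv /x; case: (ori e) => /=; rewrite ?y0 //.
  by rewrite subr_ge0 yl gerBl.
have [s0|s0] := eqVneq (sin (phi w e)) 0; last first.
  have := sub 0; rewrite mulr0 addr0 lexx ltW // => /(_ isT)/eqP.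
  by rewrite mulf_eq0 (negPf s0) orbF => /eqP.
(* Within the edge and at most a quarter turn up, so that [sin (w * y)] is positive. *)
pose y := Num.min (len e) (pi / 2 / w).
have pi0 := pi_gt0 R.
have y0 : 0 < y by rewrite lt_min l0 !divr_gt0.
have sy : 0 < sin (w * y).
  apply: sin_gt0_pi; rewrite mulr_gt0 //=.
  have : y <= pi / 2 / w by rewrite ge_min lexx orbT.
  rewrite ler_pdivlMr // mulrC => h; lra.
have := sub y; rewrite sinD s0 mul0r add0r (ltW y0) ge_min lexx => /(_ isT)/eqP.
rewrite !mulf_eq0 (negPf (cos_neq0 s0)) (gt_eqF sy) !orbF.
by move=> /eqP.
Qed.

(* The total flux of [f f'] into the vertices vanishes by the vertex conditions,
   while each edge contributes a nonnegative amount. *)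
Lemma eigenspace_nonpos nu (f : graph_fun G) : nu <= 0 -> dirichlet_eigenspace nu f ->
  forall e, {in `[0, len e], forall x, f e x = 0}.
Proof.
move=> nu0 [freg [fcont fleaf fkir] feq].
pose flux e b := f e (end_pos e b) * deriv_into f e b.
have edgeP e : 0 <= flux e false + flux e true /\
    (flux e false + flux e true = 0 -> {in `[0, len e], forall x, f e x = f e 0}).
  have [h1 h2 h3 h4] := freg e.
  have [] := nonpos_edge (len_gt0 e) nu0 h1 h2 h3 h4 (feq e).
  rewrite /flux /deriv_into /end_pos mulrN addrC subr_ge0 => -> h; split => // e0'.
  by apply: h; apply/esym/eqP; rewrite -subr_eq0 e0'.
have sum0 : \sum_e (flux e false + flux e true) = 0.
  transitivity (\sum_(p : edge G * bool) flux p.1 p.2).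
    rewrite -(pair_bigA _ flux) /=; apply: eq_bigr => e _.
    by rewrite big_bool addrC.
  rewrite (partition_big (fun p => endpoint p.1 p.2) xpredT) //= big1 // => v _.
  have [lv|nlv] := pselect (is_leaf v).
    by rewrite big1 // => p /eqP pv; rewrite /flux fleaf ?mul0r // pv.
  case: (pickP [pred p : edge G * bool | endpoint p.1 p.2 == v]) => [q /= /eqP qv|nop].
    rewrite (eq_bigr (fun p => f q.1 (end_pos q.1 q.2) * deriv_into f p.1 p.2)).
      by rewrite -mulr_sumr fkir ?mulr0.
    move=> p /eqP pv; rewrite /flux; congr (_ * _); apply: fcont.
    by rewrite pv qv.
  by rewrite big_pred0.
have const e : {in `[0, len e], forall x, f e x = f e 0}.
  have [_] := edgeP e; apply; apply/eqP; move/eqP: sum0.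
  rewrite psumr_eq0 => [/allP/(_ e)|e' _]; last by have [] := edgeP e'.
  by rewrite mem_index_enum => /(_ isT).
have const_end e b b' : f e (end_pos e b) = f e (end_pos e b').
  by rewrite !const ?end_pos_itv.
suff z e : f e (end_pos e (~~ ori e)) = 0.
  by move=> e x xl; rewrite const // -(const _ _ (end_pos_itv e (~~ ori e))).
elim/(top_down_ind depth_upper lower_surj upper_root): e => [|p c /eqP pc IH].
  have /eqP e0r : upper e0 == r by rewrite upper_root.
  by apply: fleaf; rewrite -/(upper e0) e0r.
by rewrite -IH (const_end p _ (ori p)); apply: fcont.
Qed.

(** * Counting eigenvalues by half turns *)

Local Notation jump := (turns_jump lower upper e0 len phi).
Local Notation count := (turns e0 len phi).

(** Otherwise some nontrivial combination would vanish on all free edges, hence everywhere. *)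
Lemma lin_indep_jump k (F : 'I_k -> graph_fun G) w (A : {pred 'I_k}) : 0 < w ->
  lin_indep F -> (forall i, i \in A -> dirichlet_eigenspace (w ^+ 2) (F i)) ->
  (#|A| <= jump w)%N.
Proof.
move=> w0 indF eigF; rewrite -(card_free lower_inj lower_surj lower_root upper_root).
rewrite leqNgt; apply/negP => ltA.
have /choice[t tP] : forall i, exists t, i \in A -> amplitude w t /\
    forall e, {in `[0, len e], forall x, F i e x = wave w t e x}.
  move=> i; have [Ai|nAi] := boolP (i \in A); last by exists (fun=> 0).
  by have [t] := eigenspace_wave w0 (eigF i Ai); exists t.
have [c [cA [i ci] c0]] := exists_dependency t ltA.
have ampT : amplitude w (fun e => \sum_i c i * t i e).
  apply: amplitude_sum => j cj; have /tP[] // : j \in A.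
  by apply: contraR cj => /cA ->.
have T0 := amplitude_free0 depth_upper lower_inj lower_surj lower_root upper_root ampT c0.
move/eqP: ci; apply; apply: indF => e x xl.
transitivity (wave w (fun e => \sum_i c i * t i e) e x); last by rewrite /wave T0 mul0r.
rewrite /wave mulr_suml; apply: eq_bigr => j _.
have [Aj|nAj] := boolP (j \in A); last by rewrite cA // !mul0r.
by have [_ ->//] := tP j Aj; rewrite mulrA.
Qed.

(** Amplitudes dual to the free edges: each is 1 on one of them and 0 on the others. *)
Lemma exists_independent_amplitudes w n : (n <= jump w)%N ->
  exists t : 'I_n -> edge G -> R, (forall i, amplitude w (t i)) /\
    forall c : 'I_n -> R, (forall e, \sum_i c i * t i e = 0) -> forall i, c i = 0.
Proof.
rewrite -(card_free lower_inj lower_surj lower_root upper_root) => le_n.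
pose s (i : 'I_n) := enum_val (widen_ord le_n i).
have /choice[t tP] : forall i : 'I_n, exists t, amplitude w t /\
    forall e, free_edge lower upper len phi w e -> t e = (e == s i)%:R.
  move=> i.
  have [t] := exists_amplitude depth_upper lower_inj lower_surj lower_root upper_root phiE
    w (fun e => (e == s i)%:R).
  by exists t.
exists t; split=> [i|c c0 i]; first by have [] := tP i.
rewrite -(c0 (s i)) (bigD1 i) //=.
have free_s : free_edge lower upper len phi w (s i) by exact: (enum_valP (widen_ord le_n i)).
have [_ /(_ _ free_s) ->] := tP i; rewrite eqxx mulr1 big1 ?addr0 // => j ji.
have [_ /(_ _ free_s) ->] := tP j; rewrite (inj_eq enum_val_inj).
rewrite -(inj_eq val_inj) /= eq_sym; case: eqP => [/val_inj ij|_]; last by rewrite mulr0.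
by rewrite ij eqxx in ji.
Qed.

Lemma le_turns w w' : w <= w' -> count w <= count w'.
Proof.
rewrite le_eqVlt => /predU1P[->//|ww'].
have := turns_strict depth_upper lower_inj lower_surj lower_root upper_root
  (@len_gt0 _ G) phiE ww'.
by apply: le_trans; rewrite lerDl.
Qed.

Lemma eigenvalue_gt0 k (F : 'I_k -> graph_fun G) i nu :
  lin_indep F -> dirichlet_eigenspace nu (F i) -> 0 < nu.
Proof.
move=> indF eigF; rewrite ltNge; apply/negP => nu0.
have z := eigenspace_nonpos nu0 eigF.
suff /(_ i)/eqP : forall j, (j == i)%:R = 0 :> R by rewrite eqxx oner_eq0.
apply: indF => e x xl; rewrite (bigD1 i) //= eqxx mul1r z // big1 ?addr0 // => j /negPf ->.
by rewrite mul0r.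
Qed.

Lemma turns_exp2 n w : 2 ^+ n * count w <= count (2 ^+ n * w).
Proof.
elim: n => [|n IH]; first by rewrite !expr0 !mul1r.
rewrite !exprS -!mulrA; apply: le_trans (turns_double e0 depth_upper phiE _).
by rewrite ler_pM2l.
Qed.

(** Induction on the number of eigenvalues counted: removing the largest one with its whole
    multiplicity steps over one jump of [turns]. *)
Lemma eigenvalues_le_turns k (F : 'I_k -> graph_fun G) nu w : 0 < w ->
  lin_indep F -> (forall i, dirichlet_eigenspace (nu i) (F i)) ->
  #|[pred i | nu i <= w ^+ 2]|%:Z <= count w.
Proof.
move=> w0 indF eigF.
have nu0 i : 0 < nu i by apply: (eigenvalue_gt0 indF) (eigF i).
have [n] := ubnP #|[pred i | nu i <= w ^+ 2]|.
elim: n w w0 => // n IH w w0; rewrite ltnS => le_n.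
case: (pickP [pred i | nu i <= w ^+ 2]) => [i0 i0w|nop]; last first.
  by rewrite eq_card0 //; apply: (turns_ge0 e0 depth_upper (@len_gt0 _ G) phiE (ltW w0)).
have [i iw i_max] := @arg_maxP _ _ _ i0 [pred i | nu i <= w ^+ 2] nu i0w.
pose w1 := Num.sqrt (nu i).
have w1_gt0 : 0 < w1 by rewrite sqrtr_gt0.
have w1E : w1 ^+ 2 = nu i by rewrite sqr_sqrtr // ltW.
have w1w : w1 <= w by rewrite -ler_sqr ?nnegrE ?(ltW w0) ?(ltW w1_gt0) // w1E; exact: iw.
(* Just below [w1] all smaller eigenvalues are still counted; the multiplicity of [nu i] is paid for
   by the jump at [w1]. *)
have [w2 [w2_gt0 w21 w2P]] : exists w2, [/\ 0 < w2, w2 < w1 &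
    forall j, nu j < nu i -> nu j <= w2 ^+ 2].
  have H : \forall w2 \near w1^'-, forall j, nu j < nu i -> nu j <= w2 ^+ 2.
    apply: filter_forall => j; have [ji|_] := boolP (nu j < nu i); last by near=> w2.
    near=> w2 => _; have jw2 : Num.sqrt (nu j) < w2.
      by near: w2; apply: nbhs_left_gt; rewrite /w1 ltr_sqrt ?nu0.
    rewrite -[nu j]sqr_sqrtr ?(ltW (nu0 j)) // ler_sqr ?nnegrE ?sqrtr_ge0 ?(ltW jw2) //.
    by rewrite (le_trans (sqrtr_ge0 _) (ltW jw2)).
  have [w2 [[h1 h2] h3]] := filter_ex (filterI (filterI (nbhs_left_gt w1_gt0)
    (nbhs_left_lt w1)) H).
  by exists w2.
have split_card : (#|[pred j | (nu j <= w ^+ 2)%R]| <=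
    #|[pred j | (nu j <= w2 ^+ 2)%R]| + #|[pred j | nu j == nu i]|)%N.
  rewrite -cardUI; apply: (leq_trans _ (leq_addr _ _)).
  apply: subset_leq_card; apply/fintype.subsetP => j; rewrite !inE => jw.
  have : nu j <= nu i := i_max j jw; rewrite le_eqVlt => /orP[->|/w2P ->//].
  by rewrite orbT.
have lt_card : (#|[pred j | (nu j <= w2 ^+ 2)%R]| < #|[pred j | (nu j <= w ^+ 2)%R]|)%N.
  apply: proper_card; apply/properP; split.
    apply/fintype.subsetP => j; rewrite !inE => jw2; apply: (le_trans jw2).
    by rewrite ler_sqr ?nnegrE ?(ltW w2_gt0) ?(ltW w0) // (ltW (lt_le_trans w21 w1w)).
  exists i; rewrite !inE // -ltNge -w1E.
  by rewrite ltr_sqr ?nnegrE ?(ltW w2_gt0) ?(ltW w1_gt0).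
have := IH w2 w2_gt0 (leq_trans lt_card le_n).
have : (#|[pred j | nu j == nu i]| <= jump w1)%N.
  apply: (@lin_indep_jump _ F) => // j; rewrite inE w1E => /eqP <-; exact: eigF.
have := turns_strict depth_upper lower_inj lower_surj lower_root upper_root
  (@len_gt0 _ G) phiE w21.
have := le_turns w1w; move: split_card; lia.
Unshelve. all: by end_near. Qed.

(** The count first reaches n at some [w1]. The waves for the half turns made before come from
    induction, the missing ones from the jump at [w1]. *)
Lemma exists_waves n w : 0 < w -> n%:Z <= count w ->
  exists (om : 'I_n -> R) (t : 'I_n -> edge G -> R),
    (forall i, 0 < om i <= w /\ amplitude (om i) (t i)) /\
    lin_indep (fun i => wave (om i) (t i)).
Proof.
have [N] := ubnP n; elim: N n w => // N IH n w; rewrite ltnS => nN w0 nw.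
have [n0|n_gt0] := posnP n.
  by subst n; exists (fun=> 0), (fun=> (fun=> 0)); split=> [[]//|c _ []//].
pose S := [set x : R | 0 <= x /\ n%:Z <= count x].
have Sw : S w by split => //; exact: ltW.
have S_inf : has_inf S by split; [exists w|exists 0 => x []].
pose w1 := inf S.
have w1_ge0 : 0 <= w1 by apply: lb_le_inf => [|x []//]; exists w.
have w1w : w1 <= w by apply: ge_inf => //; exists 0 => x [].
have cw1 : n%:Z <= count w1.
  (* Right continuity places the infimum itself in [S]. *)
  rewrite leNgt; apply/negP => lt_n.
  have [eps /= eps0 right_w1] := turns_right e0 depth_upper (@len_gt0 _ G) phiE w1.
  have [x Sx x_lt] := inf_adherent eps0 S_inf.
  have : w1 <= x by apply: ge_inf => //; exists 0 => y [].
  rewrite le_eqVlt => /predU1P[xw1|w1x].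
    by case: Sx => _; rewrite -xw1 leNgt lt_n.
  have : count x <= count w1.
    by apply: right_w1 => //=; rewrite ltr0_norm ?subr_lt0 // opprB ltrBlDl.
  by move=> /le_lt_trans/(_ lt_n); case: Sx => _; rewrite leNgt => /negP.
have w1_gt0 : 0 < w1.
  rewrite lt_neqAle w1_ge0 andbT; apply: contraTneq cw1 => <-.
  by rewrite (turns0 e0 depth_upper phiE) -ltNge ltz_nat.
have [w2 [[w2_gt0 w21] cw2]] := filter_ex (filterI (filterI (nbhs_left_gt w1_gt0)
  (nbhs_left_lt w1)) (turns_left depth_upper lower_inj lower_surj lower_root upper_root
  (@len_gt0 _ G) phiE w1)).
have w2w : w2 <= w by rewrite (le_trans (ltW w21)).
have c0 := turns_ge0 e0 depth_upper (@len_gt0 _ G) phiE (ltW w2_gt0).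
pose p := `|count w2|%N; have pE : p%:Z = count w2 by rewrite gez0_abs.
have ltpn : (p < n)%N.
  rewrite ltnNge; apply/negP => np; have : w1 <= w2.
    apply: ge_inf; first by exists 0 => y [].
    by split; [exact: ltW|rewrite -pE lez_nat].
  by rewrite leNgt w21.
have [m en] : exists m, n = (p + m)%N by exists (n - p)%N; rewrite subnKC // ltnW.
have le_m : (m <= jump w1)%N by move: cw1 cw2; rewrite -pE en; lia.
have pw2 : p%:Z <= count w2 by rewrite pE.
have [om1 [t1 [om1P ind1]]] := IH p w2 (leq_trans ltpn nN) w2_gt0 pw2.
have [t2 [t2P ind2]] := exists_independent_amplitudes le_m.
clear IH Sw S_inf cw1 nw ltpn nN n_gt0; rewrite {}en.
pose om (i : 'I_(p + m)) := if fintype.split i is inl a then om1 a else w1.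
pose t (i : 'I_(p + m)) := match fintype.split i with inl a => t1 a | inr b => t2 b end.
have omL a : om (lshift m a) = om1 a by rewrite /om (unsplitK (inl a)).
have omR b : om (rshift p b) = w1 by rewrite /om (unsplitK (inr b)).
have tL a : t (lshift m a) = t1 a by rewrite /t (unsplitK (inl a)).
have tR b : t (rshift p b) = t2 b by rewrite /t (unsplitK (inr b)).
exists om, t; split=> [i|c c_eq0].
  rewrite /om /t; case: (fintype.split i) => [a|b]; last by rewrite w1_gt0.
  by have [/andP[h1 h2] h3] := om1P a; rewrite h1 (le_trans h2).
have c_eq0' e x : x \in `[0, len e] ->
    \sum_i om i ^+ 2 * (c i * wave (om i) (t i) e x) = 0.
  move=> xl; pose a i := if ori e then theta (om i) e else phi (om i) e.
  pose k i := if ori e then - om i else om i.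
  have wE i y : c i * wave (om i) (t i) e y = c i * t i e * sin (a i + k i * y).
    by rewrite wave_sinusoid mulrA.
  have := @sum_sinusoid_eq0 R _ (fun i => c i * t i e) a k _ (len_gt0 e) _ x xl.
  rewrite (eq_bigr (fun i => om i ^+ 2 * (c i * wave (om i) (t i) e x))) => [|i _].
    apply=> y yl; rewrite -[RHS](c_eq0 e y yl).
    by apply: eq_bigr => i _; rewrite wE.
  by rewrite wE /k; case: (ori e); rewrite ?sqrrN.
(* Subtracting [w1 ^+ 2] times the original relation removes the waves of frequency [w1]; the others
   keep a nonzero factor, their frequencies being at most [w2 < w1]. *)
have cL a : c (lshift m a) = 0.
  have /(_ a) : forall a, c (lshift m a) * (om1 a ^+ 2 - w1 ^+ 2) = 0.
    apply: ind1 => e x xl.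
    have : \sum_i (om i ^+ 2 - w1 ^+ 2) * (c i * wave (om i) (t i) e x) = 0.
      under eq_bigr do rewrite mulrBl.
      by rewrite sumrB c_eq0' // -mulr_sumr c_eq0 // mulr0 subrr.
    rewrite big_split_ord /= [X in _ + X]big1 => [|b _]; last first.
      by rewrite omR subrr mul0r.
    rewrite addr0 => h; rewrite -[RHS]h; apply: eq_bigr => b _; rewrite omL tL; ring.
  have [/andP[h1 h2] _] := om1P a.
  move/eqP; rewrite mulf_eq0 subr_eq0 => /orP[/eqP//|].
  by rewrite lt_eqF // ltr_sqr ?nnegrE ?(ltW h1) ?(ltW w1_gt0) // (le_lt_trans h2).
have cR b : c (rshift p b) = 0.
  move: b; apply: ind2; apply: (@wave_eq0 w1) => // e x xl.
  rewrite -[RHS](c_eq0 e x xl) big_split_ord /= big1 ?add0r => [|a _]; last first.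
    by rewrite cL mul0r.
  rewrite /wave mulr_suml; apply: eq_bigr => b _; rewrite omR tR; ring.
move=> i; rewrite -(splitK i); case: (fintype.split i) => [a|b] /=; [exact: cL|exact: cR].
Qed.

End MetricTree.

(** * Repeated doubling and the bound on the ratio *)

Lemma ceil_log2_bounds (R : realType) (x : R) : 1 < x ->
  exists n : nat, [/\ Num.ceil (ln x / ln 2) = n.+1%:Z :> int, x <= 2 ^+ n.+1 & 2 ^+ n <= x].
Proof.
move=> x1; have x0 : 0 < x by apply: lt_trans x1.
have l2 : 0 < ln (2 : R) by rewrite ln_gt0 // ltr1n.
have lx : 0 < ln x / ln 2 by rewrite divr_gt0 // ln_gt0.
have /andP[h1 h2] := ceil_itv (ln x / ln 2).
have c0 : 0 < Num.ceil (ln x / ln 2) by rewrite ceil_gt0.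
case E : (Num.ceil _) c0 h1 h2 => [[//|n]|//] _ h1 h2; exists n; split=> //.
  have : ln x <= ln (2 ^+ n.+1 : R).
    rewrite lnXn // -[_ *+ _.+1]mulr_natl -ler_pdivrMr //.
  by rewrite ler_ln ?posrE // exprn_gt0.
have : ln (2 ^+ n : R) <= ln x.
  rewrite lnXn // -[_ *+ n]mulr_natl -ler_pdivlMr // ltW //.
  by apply: le_lt_trans h1; rewrite intS addrC addKr.
by rewrite ler_ln ?posrE // exprn_gt0.
Qed.

(** With w the square root of mu, j <= N(w) gives k <= 2^n j <= N(2^n w), and this many independent
    waves of frequency at most 2^n w exist. *)
Lemma eigenvalue_count_scale (R : realType) (G : metric_graph R) (hG : is_tree G)
    (j k n : nat) (mu : R) : (0 < j)%N -> (k <= 2 ^ n * j)%N ->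
  eigenvalue_count_ge G j mu -> 0 <= mu /\ eigenvalue_count_ge G k (4 ^+ n * mu).
Proof.
move=> j0 kj [F [nu [indF eigF]]].
(* Without edges every combination vanishes trivially, so no nonempty family is independent. *)
have [e1|noE] := pselect (exists e : edge G, True); last first.
  suff /(_ (Ordinal j0))/eqP : forall i : 'I_j, 1 = 0 :> R by rewrite oner_eq0.
  by apply: indF => e; case: noE; exists e.
case: e1 => e1 _; have [r [ori [depth [e0 [leaf_r depth_lt o_inj o_surj o_root]]]]] :=
  exists_leaf_rooting hG e1.
have depth_upper e : (depth (upper ori e) < depth (lower ori e))%N by have [] := depth_lt e.
have lower_root e : lower ori e != r by have [] := depth_lt e.
have [phi phiE] := exists_angle depth_upper (@len R G).
pose i0 := Ordinal j0.
have mu0 : 0 < mu.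
  have [nu_mu eig0] := eigF i0; apply: lt_le_trans nu_mu.
  exact: (eigenvalue_gt0 leaf_r depth_upper o_surj o_root indF eig0).
split; first exact: ltW.
pose w := Num.sqrt mu; have w0 : 0 < w by rewrite sqrtr_gt0.
have wE : w ^+ 2 = mu by rewrite sqr_sqrtr // ltW.
have count_w : j%:Z <= turns e0 (@len R G) phi w.
  have := eigenvalues_le_turns leaf_r depth_upper o_inj o_surj lower_root o_root phiE w0 indF
    (fun i => (eigF i).2).
  by rewrite eq_cardT ?size_enum_ord // => i; rewrite inE wE (eigF i).1.
have [||om [t [omP ind]]] := @exists_waves _ _ _ _ _ _ depth_upper o_inj o_surj
    lower_root o_root _ phiE k (2 ^+ n * w).
- by rewrite mulr_gt0 // exprn_gt0.
- apply: le_trans (turns_exp2 e0 depth_upper phiE n w).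
  apply: le_trans (_ : 2 ^+ n * j%:Z <= _); last by rewrite ler_pM2l // exprn_gt0.
  by rewrite -[2]/(2%:Z) -!natz -natrX -natrM ler_nat.
exists (fun i => wave ori phi (om i) (t i)), (fun i => om i ^+ 2); split => // i.
have [/andP[om_gt0 om_le] amp] := omP i; split.
  have -> : 4 ^+ n * mu = (2 ^+ n * w) ^+ 2.
    by rewrite exprMn wE exprAC -[in RHS]natrX.
  by rewrite ler_sqr ?nnegrE ?(ltW om_gt0) // (le_trans (ltW om_gt0)).
exact: (wave_eigenspace leaf_r o_inj o_surj lower_root o_root phiE amp).
Qed.

Lemma eigenvalue_scale (R : realType) (G : metric_graph R) (hG : is_tree G)
    (j k n : nat) : (0 < j)%N -> (0 < k)%N -> (k <= 2 ^ n * j)%N ->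
  dirichlet_eigenvalue G k / dirichlet_eigenvalue G j <= 4 ^+ n.
Proof.
move=> j0 k0 kj; rewrite /dirichlet_eigenvalue.
set Sj := [set mu | eigenvalue_count_ge G j mu].
set Sk := [set mu | eigenvalue_count_ge G k mu].
have n4 : 0 < 4 ^+ n :> R by rewrite exprn_gt0.
(* The infimum of the empty set is 0 and so is the inverse of 0, hence the quotient is 0 here. *)
have [->|/set0P Sj0] := eqVneq Sj set0; first by rewrite inf0 invr0 mulr0 ltW.
have inf_ge0 : 0 <= inf Sj.
  by apply: lb_le_inf => // mu /(eigenvalue_count_scale hG j0 kj)[].
have [->|infj] := eqVneq (inf Sj) 0; first by rewrite invr0 mulr0 ltW.
rewrite ler_pdivrMr ?lt_neqAle ?inf_ge0 1?eq_sym ?infj // -ler_pdivrMl //.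
apply: lb_le_inf => // mu Sjmu; rewrite ler_pdivrMl //.
have [_ Skmu] := eigenvalue_count_scale hG j0 kj Sjmu.
apply: ge_inf => //; exists 0 => nu Sknu.
(* Scaling with exponent 0 provides the lower bound 0 for [Sk]. *)
have k1 : (1 <= 2 ^ 0 * k)%N by rewrite mul1n.
by have [] := eigenvalue_count_scale hG k0 k1 Sknu.
Qed.

Theorem corollary1p5 (R : realType) (G : metric_graph R) (hG : is_tree G)
    (j k : nat) (hj : (1 <= j)%N) (hjk : (j < k)%N) :
  dirichlet_eigenvalue G k / dirichlet_eigenvalue G j
    <= (4 : R) ^ Num.ceil (ln (k%:R / j%:R : R) / ln 2)
    <= 4 * (k%:R ^+ 2 / j%:R ^+ 2).
Proof.
have j0 : 0 < j%:R :> R by rewrite ltr0n.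
have kj1 : 1 < k%:R / j%:R :> R by rewrite ltr_pdivlMr // mul1r ltr_nat.
have [n [-> h1 h2]] := ceil_log2_bounds kj1.
rewrite -exprnP; apply/andP; split.
  apply: eigenvalue_scale => //; first exact: ltn_trans hjk.
  by rewrite -(ler_nat R) natrM natrX -ler_pdivrMr.
(* One factor 4 pays for rounding up; the rest is the square of [2 ^+ n <= k%:R / j%:R]. *)
rewrite exprS ler_pM2l // -expr_div_n.
have -> : (4 : R) = 2 ^+ 2 by rewrite -natrX.
by rewrite exprAC ler_sqr // nnegrE ?exprn_ge0 // (le_trans ler01 (ltW kj1)).
Qed.
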